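(* Let $n\ge 1$ be an integer and $\lambda,\lambda_1,\lambda_2,\beta>0$. Let $G_N^{(n)}$ be a compound Poisson-Erlang process with parameters $\lambda,n,\beta$, let $Y^{(n)}(t)=\inf\{u\ge0:G_N^{(n)}(u)>t\}$, $t\ge0$, be its inverse process, let $N_1,N_2$ be Poisson processes with intensities $\lambda_1,\lambda_2$, and let $N_1,N_2,Y^{(n)}$ be independent. Put $S_I^{(n)}(t)=N_1(Y^{(n)}(t))-N_2(Y^{(n)}(t))$. Then the probabilities $r_k(t)=P(S_I^{(n)}(t)=k)$, $k\in\mathbb{Z}$, are given by $$r_k(t)=\lambda e^{-\beta t}\left(\frac{\lambda_1}{\lambda_2}\right)^{k/2}\sum_{m=1}^{n}(\beta t)^{m-1}\int_0^{\infty}e^{-u(\lambda_1+\lambda_2+\lambda)}\,I_{|k|}\bigl(2u\sqrt{\lambda_1\lambda_2}\bigr)\,\Phi\bigl(n,m,\lambda u(\beta t)^{n}\bigr)\,du.$$ The moment generating function is given by $$\mathsf{E}\left[e^{\theta S_I^{(n)}(t)}\right]=e^{-\beta t}\,\frac{\lambda}{\lambda+f_s(-\theta)}\sum_{k=1}^{n}(\beta t)^{k-1}\,\mathcal{E}_{n,k}\left(\frac{\lambda(\beta t)^{n}}{\lambda+f_s(-\theta)}\right)$$ for $\theta$ such that $\lambda+f_s(-\theta)\neq 0$, where $f_s(\theta)=\lambda_1(1-e^{-\theta})+\lambda_2(1-e^{\theta})$ is the Laplace exponent of the Skellam process $S(t)=N_1(t)-N_2(t)$.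
   Context: The compound Poisson-Erlang process with parameters $\lambda,n,\beta$ is $G_N^{(n)}(t)=\sum_{j=1}^{N(t)}G_j$, where $N$ is a Poisson process with intensity $\lambda$ and $G_j$ are i.i.d. Gamma random variables with integer shape $n$ and rate $\beta$, independent of $N$ (empty sum $=0$). $I_k(z)=\sum_{j=0}^{\infty}\frac{(z/2)^{2j+k}}{j!(j+k)!}$ ($k\ge0$ integer) is the modified Bessel function of the first kind; $\Phi(\rho,\delta,z)=\sum_{j=0}^{\infty}\frac{z^{j}}{j!\,\Gamma(\rho j+\delta)}$ is the Wright function; $\mathcal{E}_{\rho,\delta}(z)=\sum_{j=0}^{\infty}\frac{z^{j}}{\Gamma(\rho j+\delta)}$ is the two-parameter generalized Mittag-Leffler function.
   Formalization: The moment generating function formula is proved only where it is finite, which includes all θ with λ+f_s(-θ)>0; for λ+f_s(-θ)<0 the claimed equality is false, since the expectation is +∞ while the right-hand side is finite. *)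

(* Defs.v *)
From HB Require Import structures.
From mathcomp Require Import all_boot all_order all_algebra.
From mathcomp Require Import all_classical all_reals all_analysis.

Set Implicit Arguments.
Unset Strict Implicit.
Unset Printing Implicit Defensive.

Import Order.TTheory GRing.Theory Num.Theory.
Import numFieldNormedType.Exports.

Local Open Scope classical_set_scope.
Local Open Scope ring_scope.

Section special_functions.
Context {R : realType}.
Implicit Types rho delta x z : R.

(* Euler's integral; it is the Gamma function only for 0 < x. *)
Definition Gamma x : R :=
  \int[lebesgue_measure]_(s in `]0, +oo[) (s `^ (x - 1) * expR (- s)).

Definition besselI (k : nat) z : R :=
  limn (series (fun j => (z / 2) ^+ (2 * j + k) / (j`! * (j + k)`!)%:R)).

Definition wright rho delta z : R :=
  limn (series (fun j => z ^+ j / (j`!%:R * Gamma (rho * j%:R + delta)))).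

Definition mittag_leffler rho delta z : R :=
  limn (series (fun j => z ^+ j / Gamma (rho * j%:R + delta))).

(* Shape a, rate b. *)
Definition gamma_pdf (a b x : R) : R :=
  if 0 < x then b `^ a / Gamma a * x `^ (a - 1) * expR (- b * x) else 0.

(* The Laplace exponent f_s of N1 - N2, i.e. E[e^(-x (N1(u) - N2(u)))] =
   e^(-u f_s(x)), for independent Poisson processes of intensities l1, l2. *)
Definition skellam_exponent (l1 l2 x : R) : R :=
  l1 * (1 - expR (- x)) + l2 * (1 - expR x).

End special_functions.

Section independence.
Context d (T : measurableType d) (R : realType) (P : probability T R).

Definition mutually_independent (I : eqType) (F : I -> set (set T)) : Prop :=
  forall (J : seq I) (A : I -> set T), uniq J ->
    (forall i, i \in J -> F i (A i)) ->
    P (\bigcap_(i in [set` J]) A i) = (\prod_(i <- J) fine (P (A i)))%:E.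

Definition salgebra_of d' (T' : measurableType d') (f : T -> T') :
    set (set T) :=
  preimage_set_system setT f measurable.

Definition salgebra_of_family d' (T' : measurableType d') (I : Type)
    (D : set I) (X : I -> T -> T') : set (set T) :=
  <<s \bigcup_(i in D) salgebra_of (X i) >>.

End independence.

Section processes.
Context d (T : measurableType d) (R : realType) (P : probability T R).

(* Processes are indexed by R, but only their values at times t >= 0 are
   meaningful. *)
Definition salgebra_of_process d' (T' : measurableType d')
    (X : R -> T -> T') : set (set T) :=
  salgebra_of_family [set t | 0 <= t] X.

(* All paths (rather than almost all) are nondecreasing and right-continuous,
   so that the truncated subtraction of nat computes the increments and random
   time changes of N are measurable without completing P. *)
Record poisson_process (lambda : R) (N : R -> T -> nat) : Prop := {
  poisson_process_measurable :
    forall t : R, 0 <= t -> measurable_fun [set: T] (N t) ;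
  poisson_process_start : forall w, N 0 w = 0%N ;
  poisson_process_mono :
    forall w (s t : R), 0 <= s -> s <= t -> (N s w <= N t w)%N ;
  poisson_process_right_continuous :
    forall w (t : R), 0 <= t -> N s w @[s --> t^'+] --> N t w ;
  poisson_process_increment : forall (s t : R) k, 0 <= s -> s < t ->
    P [set w | (N t w - N s w)%N = k] =
      (poisson_pmf (lambda * (t - s)) k)%:E ;
  poisson_process_independent_increments :
    forall t : nat -> R, 0 <= t 0%N -> nondecreasing_seq t ->
    mutually_independent P
      (fun i => salgebra_of (fun w => (N (t i.+1) w - N (t i) w)%N)) }.

Definition gamma_distributed (a b : R) (X : T -> R) : Prop :=
  measurable_fun [set: T] X /\
  forall B : set R, measurable B ->
    P (X @^-1` B) =
      (\int[lebesgue_measure]_(x in B) (gamma_pdf a b x)%:E)%E.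

(* The jumps G_1, G_2, ... are numbered from 0: G_j is G j.-1. *)
Definition compound_poisson_erlang (lambda : R) (n : nat) (beta : R)
    (X : R -> T -> R) : Prop :=
  exists (N : R -> T -> nat) (G : nat -> T -> R),
  [/\ poisson_process lambda N,
      forall j, gamma_distributed n%:R beta (G j),
      mutually_independent P (fun j => salgebra_of (G j)),
      mutually_independent P (tnth [tuple salgebra_of_process N;
                                          salgebra_of_family [set: nat] G]) &
      forall (t : R) w, 0 <= t -> X t w = \sum_(j < N t w) G j w].

(* [inf] of the empty set is 0; for a compound Poisson-Erlang process the set
   below is empty with probability 0 only. *)
Definition inverse_process (X : R -> T -> R) (t : R) (w : T) : R :=
  inf [set u | 0 <= u /\ t < X u w].

Definition time_changed_skellam (N1 N2 : R -> T -> nat) (Y : R -> T -> R)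
    (t : R) (w : T) : int :=
  (N1 (Y t w) w)%:Z - (N2 (Y t w) w)%:Z.

End processes.

(* Main.v *)
Require Import Defs.
From HB Require Import structures.
From mathcomp Require Import all_boot all_order all_algebra.
From mathcomp Require Import all_classical all_reals all_analysis.
From mathcomp Require Import measurable_realfun.
From mathcomp Require Import ring.

Set Implicit Arguments.
Unset Strict Implicit.
Unset Printing Implicit Defensive.

Import Order.TTheory GRing.Theory Num.Theory.
Import numFieldNormedType.Exports.

Local Open Scope classical_set_scope.
Local Open Scope ring_scope.

(** Let K be the index of the first jump of the compound process that takes it
    above the level t. It is independent of N, and Y(t) is the K-th jump time of
    N. Since the sum of the first m jumps is Erlang of shape m n, it exceeds t
    with the probability that a Poisson variable of mean beta t is less than
    m n, so that K = m + 1 has as probability a block of n consecutive Poisson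
    weights. Hence Y(t) has the density
      u |-> sum_m P(K = m + 1) lambda (lambda u)^m / m! e^(- lambda u),
    and regrouping the terms by their rank in the block makes the Wright
    functions appear. As N1, N2 and Y(t) are independent, conditioning on
    Y(t) = u gives
      P(N1(Y(t)) = i, N2(Y(t)) = j) = int P(N1(u) = i) P(N2(u) = j) f(u) du.
    Summing over i - j = k yields the Bessel function, and summing against
    e^(theta (i - j)) yields the Laplace transform of Y(t) at f_s(- theta), a
    series of powers of lambda / (lambda + f_s(- theta)). *)

(** * Poisson weights and Erlang integrals *)

Section ftc.
Context {R : realType}.
Notation mu := (@lebesgue_measure R).
Implicit Types (f F : R -> R).

(** Conditioning is done without product measures or conditional laws. The random variable is
    replaced by a representative of its cell in a fine partition; on each cell independence is a
    product formula, and dominated convergence passes to the limit. The same argument gives the law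
    of the partial sums and that of the time-changed pair, and yields the measurability of events at
    random times. The identity P(Y(t) <= x) = P(G_N(x) > t) holds only up to null sets: where the
    level is never passed the infimum is 0, and a nonpositive jump would break the monotonicity of
    the paths. The first event is null because the candidate density has total mass at least 1. Sums
    and integrals have nonnegative terms and live in the extended reals, so that interchanges need
    no summability. If lambda + f_s(- theta) < 0, the moment generating function is infinite while
    the closed form is a real number, so the closed form is claimed under finiteness. *)

Lemma is_derive1_continuous f (x a : R) : is_derive x (1 : R) f a ->
  {for x, continuous f}.
Proof.
by move=> df; apply/differentiable_continuous/derivable1_diffP; exact: ex_derive.
Qed.

Lemma integral_is_derive_itvcc F f (a b : R) : a <= b ->
  continuous f -> (forall x, is_derive x (1 : R) F (f x)) ->
  (\int[mu]_(x in `[a, b]) (f x)%:E = (F b - F a)%:E)%E.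
Proof.
rewrite le_eqVlt => /predU1P[->|ab] cf dF.
  by rewrite set_itv1 integral_set1 subrr.
have cF : continuous F by move=> x; apply: is_derive1_continuous (dF x).
rewrite EFinB; apply: continuous_FTC2 => //.
- exact: continuous_subspaceT.
- split.
  + by move=> x _; have [] := dF x.
  + exact/cvg_at_right_filter/cF.
  + exact/cvg_at_left_filter/cF.
- by move=> x _; rewrite derive1E; have [] := dF x.
Qed.

Lemma integral_is_derive_itvcy F f (a : R) : (forall x, a <= x -> 0 <= f x) ->
  continuous f -> (forall x, is_derive x (1 : R) F (f x)) ->
  F x @[x --> +oo] --> 0 ->
  (\int[mu]_(x in `[a, +oo[) (f x)%:E = (- F a)%:E)%E.
Proof.
move=> f0 cf dF F0.
have cF : continuous F by move=> x; apply: is_derive1_continuous (dF x).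
rewrite (@ge0_continuous_FTC2y _ f F a 0) ?sub0e //.
- exact: continuous_subspaceT.
- exact/cvg_at_right_filter/cF.
- by move=> x _; rewrite derive1E; have [] := dF x.
Qed.

End ftc.

Section poisson_weights.
Context {R : realType}.
Implicit Types (x a b t : R) (k n : nat).

(* Unlike [poisson_pmf], this is the right weight also for the mean [0]. *)
Definition poi x k : R := exp_coeff x k * expR (- x).

(** The probability that a Poisson variable of mean [x] is less than [k], which for positive [k] is
    the probability that an Erlang variable of shape [k] and rate 1 exceeds [x]. *)
Definition poi_sum k x : R := \sum_(i < k) poi x i.

Lemma exp_coeffS x k : exp_coeff x k.+1 = exp_coeff x k * (x / k.+1%:R).
Proof.
rewrite /exp_coeff /= exprSr factS natrM invfM -!mulrA; congr (_ * _).
by rewrite [RHS]mulrCA; congr (_ * _); rewrite mulrC.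
Qed.

Lemma exp_coeff0S k : exp_coeff 0 k.+1 = 0 :> R.
Proof. by rewrite /exp_coeff/= expr0n mul0r. Qed.

Lemma poi_ge0 x k : 0 <= x -> 0 <= poi x k.
Proof. by move=> x0; rewrite mulr_ge0 ?expR_ge0// exp_coeff_ge0. Qed.

Lemma poi_sum_ge0 k x : 0 <= x -> 0 <= poi_sum k x.
Proof. by move=> x0; apply: sumr_ge0 => i _; exact: poi_ge0. Qed.

Lemma poi0 k : poi 0 k = (k == 0)%:R.
Proof.
rewrite /poi /exp_coeff/= oppr0 expR0 mulr1 expr0n.
by case: k => [|k]; rewrite /= ?mul0r// divr1.
Qed.

Lemma poisson_pmfE x k : 0 < x -> poisson_pmf x k = poi x k.
Proof. by move=> x0; rewrite /poisson_pmf x0. Qed.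

Lemma nneseries_exp_coeff x : 0 <= x ->
  (\sum_(k <oo) (exp_coeff x k)%:E = (expR x)%:E)%E.
Proof.
move=> x0; rewrite /expR -EFin_lim; last exact: is_cvg_series_exp_coeff.
by apply/congr_lim/funext => n /=; rewrite /series/= -sumEFin.
Qed.

Lemma nneseries_poi x : 0 <= x -> (\sum_(k <oo) (poi x k)%:E = 1)%E.
Proof.
move=> x0; under eq_eseriesr do rewrite /poi mulrC EFinM.
rewrite nneseriesZl/=; last by move=> n _; rewrite lee_fin exp_coeff_ge0.
by rewrite nneseries_exp_coeff// -EFinM mulrC expRxMexpNx_1.
Qed.

Lemma nneseries_poi_tail k x : 0 <= x ->
  (\sum_(k <= i <oo) (poi x i)%:E = (1 - poi_sum k x)%:E)%E.
Proof.
move=> x0.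
have p0 i : (0 <= (poi x i)%:E)%E by rewrite lee_fin poi_ge0.
have := nneseries_poi x0; rewrite (nneseries_split 0 k)//= add0n.
rewrite sumEFin big_mkord -/(poi_sum k x) => H.
have H1 : (\sum_(k <= i <oo) (poi x i)%:E \is a fin_num)%E.
  rewrite ge0_fin_numE ?nneseries_ge0//.
  apply: (@le_lt_trans _ _ 1%E); last by rewrite ltry.
  by rewrite -H leeDr// lee_fin poi_sum_ge0.
by rewrite -(fineK H1) in H *; move: H; rewrite -EFinD => -[<-]; rewrite addrAC subrr add0r.
Qed.

Lemma poi_sum_le1 k x : 0 <= x -> poi_sum k x <= 1.
Proof.
move=> x0; rewrite -subr_ge0 -lee_fin -nneseries_poi_tail//.
by apply: nneseries_ge0 => i _ _; rewrite lee_fin poi_ge0.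
Qed.

Lemma is_derive_exp_coeffS x k :
  is_derive x (1 : R) (fun y => exp_coeff y k.+1) (exp_coeff x k).
Proof.
rewrite /exp_coeff /=.
have -> : (fun y : R => y ^+ k.+1 / k.+1`!%:R) =
  (k.+1`!%:R)^-1 \*: (id ^+ k.+1).
  by apply/funext => y; rewrite exprfctE /GRing.scale/= mulrC.
apply: (is_derive_eq (is_deriveZ _ (is_deriveX _ (is_derive_id _ _)))).
rewrite /GRing.scale/= mulr1.
rewrite factS natrM.
have : k.+1%:R != 0 :> R by rewrite pnatr_eq0.
have : k`!%:R != 0 :> R by rewrite pnatr_eq0 -lt0n fact_gt0.
by move=> ? ?; field; apply/andP.
Qed.


Lemma is_derive_poi0 x : is_derive x (1 : R) (poi ^~ 0%N) (- poi x 0).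
Proof.
have -> : poi^~ 0%N = expR \o -%R.
  by apply/funext => y; rewrite /poi /exp_coeff/= expr0 divr1 mul1r.
apply: (is_derive_eq (is_derive1_comp _ _)).
by rewrite /poi /exp_coeff/= expr0 divr1 mul1r mulrN1.
Qed.

Lemma is_derive_poiS x k :
  is_derive x (1 : R) (poi ^~ k.+1) (poi x k - poi x k.+1).
Proof.
have -> : poi^~ k.+1 = (fun y => exp_coeff y k.+1) * (expR \o -%R).
  by [].
have d1 := is_derive_exp_coeffS x k.
have d2 : is_derive x (1 : R) (expR \o -%R) (- expR (- x)).
  by apply: (is_derive_eq (is_derive1_comp _ _)); rewrite mulrN1.
apply: (is_derive_eq (is_deriveM d1 d2)).
by rewrite /GRing.scale/= /poi; ring.
Qed.

(** The derivatives of the single weights telescope. Thus [- poi_sum k.+1] is a primitive of the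
    Erlang density of shape [k + 1], and all Erlang integrals below come from it. *)
Lemma is_derive_poi_sum x k :
  is_derive x (1 : R) (poi_sum k.+1) (- poi x k).
Proof.
elim: k => [|k ih].
  rewrite [poi_sum 1](_ : _ = poi ^~ 0%N); first exact: is_derive_poi0.
  by apply/funext => y; rewrite /poi_sum big_ord_recr/= big_ord0 add0r.
rewrite [poi_sum k.+2](_ : _ = poi_sum k.+1 + poi ^~ k.+1); last first.
  by apply/funext => y; rewrite /poi_sum big_ord_recr.
have := is_derive_poiS x k => H.
by apply: (is_derive_eq (is_deriveD ih H)); ring.
Qed.

Lemma is_derive_scale_comp (F : R -> R) a x df :
  is_derive (a * x) (1 : R) F df ->
  is_derive x (1 : R) (fun y => F (a * y)) (a * df).
Proof.
move=> dF; have d1 : is_derive x (1 : R) ( *%R a) a.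
  have := is_deriveZ a (is_derive_id x (1 : R)).
  by rewrite /GRing.scale/= mulr1.
by rewrite mulrC; exact: (@is_derive1_comp _ F ( *%R a)).
Qed.

Lemma continuous_poi k : continuous (poi^~ k).
Proof.
move=> x; case: k => [|k].
  exact: is_derive1_continuous (is_derive_poi0 x).
exact: is_derive1_continuous (is_derive_poiS x k).
Qed.

Lemma poi_sum_cvg0 k a : 0 < a -> poi_sum k (a * x) @[x --> +oo] --> 0.
Proof.
move=> a0.
(* [expR y] dominates its term of degree [i + 1], which is [exp_coeff y i] times [y / (i + 1)]. *)
have poi_le y i : 0 < y -> poi y i <= i.+1%:R / y.
  move=> y0; rewrite /poi expRN ler_pdivrMr ?expR_gt0// mulrAC ler_pdivlMr//.
  rewrite -ler_pdivrMl// mulrC -mulrA -exp_coeffS.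
  have := expR_ge1Dxn i (ltW y0); apply: le_trans.
  by rewrite /exp_coeff/= lerDr.
have c0 (c : R) : c / x @[x --> +oo] --> 0.
  rewrite -[X in _ --> X](mulr0 c); apply: cvgM; first exact: cvg_cst.
  apply/gtr0_cvgV0; last exact: cvg_id.
  exact: nbhs_pinfty_gt.
rewrite /poi_sum.
elim: k => [|k ih].
  by under eq_fun do rewrite big_ord0; exact: cvg_cst.
have -> : (fun x => \sum_(i < k.+1) poi (a * x) i) =
    (fun x => \sum_(i < k) poi (a * x) i + poi (a * x) k).
  by apply/funext => x; rewrite big_ord_recr.
rewrite -[X in _ --> X]addr0; apply: cvgD; first exact: ih.
apply: (@squeeze_cvgr _ _ _ _ (cst 0) (fun x => k.+1%:R / a / x)).
- near=> x; have x0 : 0 < x by near: x; exact: nbhs_pinfty_gt.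
  rewrite /= poi_ge0 ?mulr_ge0 ?(ltW a0) ?(ltW x0)//=.
  by rewrite -mulrA -invfM; apply: poi_le; rewrite mulr_gt0.
- exact: cvg_cst.
- exact: c0.
Unshelve. all: end_near. Qed.

Lemma integral_poi_itvcc a x k : 0 <= x ->
  (\int[lebesgue_measure]_(u in `[0%R, x]) (a * poi (a * u) k)%:E =
   (1 - poi_sum k.+1 (a * x))%:E)%E.
Proof.
move=> x0.
have dF u : is_derive u (1 : R) (fun u => - poi_sum k.+1 (a * u))
    (a * poi (a * u) k).
  have := is_derive_scale_comp (is_derive_poi_sum (a * u) k).
  by move=> /is_deriveN; rewrite mulrN opprK.
rewrite (integral_is_derive_itvcc x0 _ dF).
- rewrite mulr0 opprK addrC; congr (_ - _)%:E.
  rewrite /poi_sum big_ord_recl poi0 big1 ?addr0// => i _.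
  by rewrite poi0.
- move=> u; apply: (@cvgM _ _ _ _ (cst a)); first exact: cvg_cst.
  apply: (@continuous_comp _ _ _ ( *%R a) (poi^~ k)).
    exact: mulrl_continuous.
  exact: continuous_poi.
Qed.

Lemma integral_poi_itvcy a x k : 0 < a -> 0 <= x ->
  (\int[lebesgue_measure]_(u in `[x, +oo[) (a * poi (a * u) k)%:E =
   (poi_sum k.+1 (a * x))%:E)%E.
Proof.
move=> a0 x0.
have dF u : is_derive u (1 : R) (fun u => - poi_sum k.+1 (a * u))
    (a * poi (a * u) k).
  have := is_derive_scale_comp (is_derive_poi_sum (a * u) k).
  by move=> /is_deriveN; rewrite mulrN opprK.
rewrite (integral_is_derive_itvcy _ _ dF).
- by rewrite opprK.
- move=> u xu; apply: mulr_ge0; first exact: ltW.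
  by apply: poi_ge0; apply: mulr_ge0; [exact: ltW|exact: le_trans xu].
- move=> u; apply: (@cvgM _ _ _ _ (cst a)); first exact: cvg_cst.
  apply: (@continuous_comp _ _ _ ( *%R a) (poi^~ k)).
    exact: mulrl_continuous.
  exact: continuous_poi.
- by rewrite -[X in _ --> X]oppr0; apply: cvgN; exact: poi_sum_cvg0.
Qed.

(* Integrating [exp_coeff (t - x) i * exp_coeff x k] by parts [i] times. *)
Fixpoint conv_primitive t i k x : R :=
  if i is j.+1 then
    exp_coeff (t - x) i * exp_coeff x k.+1 + conv_primitive t j k.+1 x
  else exp_coeff x k.+1.

Lemma is_derive_conv_primitive t i k x :
  is_derive x (1 : R) (conv_primitive t i k)
    (exp_coeff (t - x) i * exp_coeff x k).
Proof.
elim: i k => [|i ih] k.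
  apply: (is_derive_eq (is_derive_exp_coeffS x k)).
  by rewrite {2}/exp_coeff/= expr0 divr1 mul1r.
have d1 : is_derive x (1 : R) (fun y => exp_coeff (t - y) i.+1)
    (- exp_coeff (t - x) i).
  have d0 : is_derive x (1 : R) (fun y => t - y) (- 1).
    apply: (is_derive_eq (is_deriveB (is_derive_cst t x _) (is_derive_id x _))).
    by rewrite sub0r.
  apply: (is_derive_eq (@is_derive1_comp _ (fun y => exp_coeff y i.+1) _ x _ _
    (is_derive_exp_coeffS (t - x) i) d0)).
  by rewrite mulrN1.
have d2 := is_derive_exp_coeffS x k.
apply: (is_derive_eq (is_deriveD (is_deriveM d1 d2) (ih k.+1))).
by rewrite /GRing.scale/=; ring.
Qed.

(** For a Poisson process of rate [b], the integrand is the density at [x] of arrival number [k + 1]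
    times the probability of exactly [i] further arrivals up to [t]; together they make [i + k + 1]
    arrivals. *)
Lemma integral_poi_conv b t i k : 0 < b -> 0 <= t ->
  (\int[lebesgue_measure]_(x in `[0%R, t])
     (poi (b * (t - x)) i * (b * poi (b * x) k))%:E =
   (poi (b * t) (i + k.+1))%:E)%E.
Proof.
move=> b0 t0.
pose c : R := expR (- (b * t)).
pose F x : R := c * conv_primitive (b * t) i k (b * x).
have dF x : is_derive x (1 : R) F (poi (b * (t - x)) i * (b * poi (b * x) k)).
  have /(is_deriveZ c) := is_derive_scale_comp (is_derive_conv_primitive (b * t) i k (b * x)).
  move=> H; apply: (is_derive_eq H); rewrite /GRing.scale/= /poi /c mulrBr.
  have -> : expR (- (b * t)) = expR (- (b * t - b * x)) * expR (- (b * x)).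
    by rewrite -expRD; congr expR; ring.
  by ring.
rewrite (integral_is_derive_itvcc t0 _ dF).
(* At 0 every summand of the primitive has a vanishing factor; at the upper end all do but the last
   one. *)
- have prim0 j l : conv_primitive (b * t) j l 0 = 0.
    elim: j l => [|j ih] l /=; first by rewrite exp_coeff0S.
    by rewrite ih exp_coeff0S mulr0 addr0.
  have primt j l : conv_primitive (b * t) j l (b * t) =
      exp_coeff (b * t) (j + l.+1)%N.
    elim: j l => [|j ih] l //=.
    by rewrite subrr exp_coeff0S mul0r add0r ih addSnnS.
  by rewrite /F mulr0 prim0 primt mulr0 subr0 /poi mulrC.
- move=> x; apply: cvgM; last first.
    apply: (@cvgM _ _ _ _ (cst b)); first exact: cvg_cst.
    apply: (@continuous_comp _ _ _ ( *%R b) (poi^~ k)).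
      exact: mulrl_continuous.
    exact: continuous_poi.
  apply: (@continuous_comp _ _ _ (fun x => b * (t - x)) (poi^~ i)).
    apply: (@cvgM _ _ _ _ (cst b)); first exact: cvg_cst.
    by apply: (@cvgB _ R^o); [exact: cvg_cst|exact: cvg_id].
  exact: continuous_poi.
Qed.

Lemma Gamma_nat n : Gamma (n.+1%:R : R) = n`!%:R.
Proof.
rewrite /Gamma /Rintegral.
have -> : (\int[lebesgue_measure]_(s in `]0%R, +oo[)
    (s `^ (n.+1%:R - 1) * expR (- s))%:E)%E = (n`!%:R : R)%:E; last by [].
transitivity (\int[lebesgue_measure]_(s in `]0%R, +oo[)
    ((n`!%:R)%:E * (poi s n)%:E : \bar R))%E.
  apply: eq_integral => s; rewrite inE/= in_itv/= andbT => s0.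
  rewrite -natr1 addrK powR_mulrn ?ltW// -EFinM /poi /exp_coeff/= mulrA.
  by rewrite mulrCA mulfV ?mulr1// pnatr_eq0 -lt0n fact_gt0.
rewrite ge0_integralZl_EFin//.
- rewrite (@integral_itv_obnd_cbnd _ _ +oo%O)//; last first.
    by apply/measurable_EFinP; apply: measurable_funTS;
      apply: continuous_measurable_fun; exact: continuous_poi.
  under eq_integral do rewrite -[s in poi s n]mul1r -[poi _ _]mul1r.
  rewrite integral_poi_itvcy// mulr0.
  rewrite /poi_sum big_ord_recl poi0 big1 ?addr0 ?mule1// => i _.
  by rewrite poi0.
- by move=> x /=; rewrite in_itv/= andbT => x0; rewrite lee_fin poi_ge0// ltW.
- by apply/measurable_EFinP; apply: measurable_funTS;
    apply: continuous_measurable_fun; exact: continuous_poi.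
Qed.

End poisson_weights.

(** * Freezing an independent random variable *)

Section freezing.
Context d (T : measurableType d) (R : realType) (P : probability T R).
Notation mu := (@lebesgue_measure R).

(** Dominated convergence for indicators. Measurability of [B] is a conclusion: pointwise eventual
    agreement makes [B] the limit inferior of the [A l]. *)
Lemma cvg_probability (A : (set T)^nat) (B : set T) :
  (forall l, measurable (A l)) ->
  (forall w, \forall l \near \oo, A l w <-> B w) ->
  measurable B /\ P (A l) @[l --> \oo] --> P B.
Proof.
move=> mA AB.
have mB : measurable B.
  have -> : B = \bigcup_n \bigcap_(l in [set l | (n <= l)%N]) A l.
    apply/seteqP; split => w.
      move=> Bw; have [N _ NAB] := AB w.
      by exists N => // l /= Nl; apply/(NAB l).
    move=> [n _ nA]; have [N _ NAB] := AB w.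
    apply/(NAB (maxn n N)) => /=; first exact: leq_maxr.
    by apply: nA => /=; exact: leq_maxl.
  apply: bigcupT_measurable => n; apply: bigcap_measurable => //.
  by exists n => /=.
split=> //.
have -> : P B = (\int[P]_(w in setT) (\1_B w)%:E)%E.
  by rewrite integral_indic ?setIT.
have -> : (fun l => P (A l)) = (fun l => \int[P]_(w in setT) (\1_(A l) w)%:E)%E.
  by apply/funext => l; rewrite integral_indic ?setIT.
apply: (@dominated_cvg _ _ _ P setT _ (fun l w => (\1_(A l) w)%:E) _ (cst 1%E)) => //.
- by move=> l; apply/measurable_EFinP; exact: measurable_indic.
- move=> w _; apply: cvg_near_cst; have := AB w; apply: filterS => l ABl.
  congr EFin; rewrite !indicE; congr (_ %:R); congr nat_of_bool.
  by apply/idP/idP; rewrite !inE => /ABl.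
- exact: finite_measure_integrable_cst.
- move=> l w _; rewrite abse_EFin ger0_norm//; rewrite lee_fin indicE.
  by case: (_ \in _).
Qed.

Local Open Scope ereal_scope.

(* The index [idx l x] selects the cell of the [l]-th partition of the line that
   contains [x], and [c l j] is the point that stands for the [j]-th cell. *)
Lemma probability_freezing (X : T -> R) (D : set R) (f : R -> \bar R)
    (E : R -> set T) (idx : nat -> R -> nat) (c : nat -> nat -> R) :
  measurable_fun setT X -> measurable D -> measurable_fun D f ->
  (forall x, D x -> 0 <= f x) -> (forall x, D x -> f x \is a fin_num) ->
  \int[mu]_(x in D) f x < +oo ->
  (forall l, measurable_fun setT (idx l)) ->
  (forall l j, P (X @^-1` (D `&` idx l @^-1` [set j])) =
    \int[mu]_(x in D `&` idx l @^-1` [set j]) f x) ->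
  (forall x, measurable (E x)) ->
  (forall l j, P (X @^-1` (D `&` idx l @^-1` [set j]) `&` E (c l j)) =
    P (X @^-1` (D `&` idx l @^-1` [set j])) * P (E (c l j))) ->
  (forall x, D x -> forall w, \forall l \near \oo, E (c l (idx l x)) w <-> E x w) ->
  [/\ measurable [set w | D (X w) /\ E (X w) w],
      measurable_fun D (fun x => P (E x)) &
      P [set w | D (X w) /\ E (X w) w] = \int[mu]_(x in D) (P (E x) * f x)].
Proof.
move=> mX mD mf f0 ffin fy midx law mE indep cvgE.
have mX' B : measurable B -> measurable (X @^-1` B).
  by move=> mB; rewrite -[X in measurable X]setTI; exact: mX.
have midx' l j : measurable (idx l @^-1` [set j]).
  by rewrite -[X in measurable X]setTI; exact: midx.
pose cell l j := D `&` idx l @^-1` [set j].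
have mcell l j : measurable (cell l j) by exact: measurableI.
have tcell l : trivIset setT (cell l).
  by move=> i j _ _ [x [[_ /= <-] [_ /= <-]]].
have Dcell l : D = \bigcup_j cell l j.
  apply/seteqP; split => x; first by move=> Dx; exists (idx l x).
  by move=> [j _ []].
(* The event with [E] frozen at the point of the cell containing [X w]. It is a countable disjoint
   union over the cells, and on each of them [E] no longer depends on [X]. *)
pose A l := [set w | D (X w) /\ E (c l (idx l (X w))) w].
pose h l x := P (E (c l (idx l x))).
have AE l : A l = \bigcup_j (X @^-1` cell l j `&` E (c l j)).
  apply/seteqP; split => w.
    by move=> [DX EX]; exists (idx l (X w)).
  by move=> [j _ [[DX /= <-] EX]].
have mA l : measurable (A l).
  by rewrite AE; apply: bigcupT_measurable => j; apply: measurableI => //; exact: mX'.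
have mh l : measurable_fun D (h l).
  apply: (@measurableT_comp _ _ _ _ _ _ (fun j => P (E (c l j)))) => //.
  exact: measurable_funTS.
have mhf l : measurable_fun D (h l \* f) by exact: emeasurable_funM.
have Pcell l j : P (X @^-1` cell l j `&` E (c l j)) =
    \int[mu]_(x in cell l j) (h l x * f x).
  transitivity (P (E (c l j)) * \int[mu]_(x in cell l j) f x).
    by rewrite muleC -law -indep.
  rewrite -ge0_integralZl//.
  - by apply: eq_integral => x; rewrite inE => -[_ /= <-].
  - exact: mcell.
  - by apply: measurable_funS mf => // x [].
  - by move=> x [Dx _]; exact: f0.
have PA l : P (A l) = \int[mu]_(x in D) (h l x * f x).
  rewrite AE measure_semi_bigcup//; last 3 first.
  - by move=> j; apply: measurableI => //; exact: mX'.
  - move=> i j _ _ [w [[[_ /= <-] _] [[_ /= <-] _]]] //.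
  - apply: bigcupT_measurable => j; apply: measurableI => //; exact: mX'.
  rewrite [in RHS](Dcell l) ge0_integral_bigcup//; last 3 first.
  - by move=> k; exact: mcell.
  - by rewrite -Dcell; exact: mhf.
  - by rewrite -Dcell => x Dx; rewrite mule_ge0// f0.
  by apply: eq_eseriesr => j _; exact: Pcell.
have cvgA w : \forall l \near \oo, A l w <-> (D (X w) /\ E (X w) w).
  have [DX|nDX] := pselect (D (X w)); last by near=> l; split=> -[].
  have := cvgE _ DX w; apply: filterS => l lE.
  by split=> -[_ /lE].
have [mEX cvgP] := cvg_probability mA cvgA.
have cvgh x : D x -> h l x @[l --> \oo] --> P (E x).
  by move=> Dx; have [] := @cvg_probability (fun l => E (c l (idx l x))) (E x)
    (fun l => mE _) (cvgE x Dx).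
have mPE : measurable_fun D (fun x => P (E x)).
  by apply: (emeasurable_fun_cvg h).
have h1 l x : h l x <= 1 by apply: probability_le1; exact: mE.
split=> //.
have cvgI : P (A l) @[l --> \oo] --> \int[mu]_(x in D) (P (E x) * f x).
  under eq_fun do rewrite PA.
  apply: (@dominated_cvg _ _ _ mu D _ (fun l x => h l x * f x) _ f) => //.
  - by move=> x Dx; apply: cvgeZr; [exact: ffin|exact: cvgh].
  - apply/integrableP; split => //.
    under eq_integral => x /[!inE] Dx do rewrite gee0_abs ?f0//.
    by [].
  - move=> l x Dx; rewrite gee0_abs ?mule_ge0 ?f0//.
    by rewrite -[leRHS]mul1e lee_wpmul2r ?f0.
by rewrite -(cvg_lim _ cvgP)// (cvg_lim _ cvgI).
Unshelve. all: end_near. Qed.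

End freezing.

(** * Sums of independent gamma variables *)

Section gamma_sums.
Context {R : realType}.
Notation mu := (@lebesgue_measure R).

Lemma measurable_fun_to_nat d (T : measurableType d) (f : T -> nat) :
  (forall n, measurable [set w | (f w <= n)%N]) -> measurable_fun setT f.
Proof.
move=> mf _ B _; rewrite setTI.
have -> : f @^-1` B = \bigcup_(n in B) (f @^-1` [set n]).
  apply/seteqP; split => w; first by move=> Bw; exists (f w).
  by move=> [n Bn /= fwn]; rewrite /preimage/= fwn.
apply: bigcup_measurable => n _.
have -> : f @^-1` [set n] = [set w | (f w <= n)%N] `\`
    (if n is m.+1 then [set w | (f w <= m)%N] else set0).
  apply/seteqP; split => w /=.
    by case: n => [|m] fwn; split => /=; rewrite ?fwn ?ltnn.
  case: n => [|m]/= [fn nfn]; first by apply/eqP; rewrite -leqn0.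
  by apply/eqP; rewrite eqn_leq fn ltnNge; apply/negP.
by apply: measurableD => //; case: n => //.
Qed.

(** Rounding down suits the events [s - x < S]: they grow with [x] and, the inequality being strict,
    hold already at points slightly below [x]. *)
Definition floor_index (l : nat) (x : R) : nat := Num.truncn (x * l.+1%:R).

Lemma measurable_floor_index l : measurable_fun setT (floor_index l).
Proof.
apply: measurable_fun_to_nat => n.
have -> : [set x : R | (floor_index l x <= n)%N] = `]-oo, n.+1%:R / l.+1%:R[%classic.
  apply/seteqP; split => x /=; rewrite /floor_index truncn_le_nat in_itv/=;
    by rewrite ltr_pdivlMr.
exact: measurable_itv.
Qed.

Lemma floor_index_le l (x : R) : 0 <= x ->
  (floor_index l x)%:R / l.+1%:R <= x < (floor_index l x)%:R / l.+1%:R + l.+1%:R^-1.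
Proof.
move=> x0; rewrite -[X in _ < _ + X]mul1r -mulrDl natr1.
rewrite ler_pdivrMr// ltr_pdivlMr//.
by apply: truncn_itv; rewrite mulr_ge0.
Qed.

Lemma gamma_pdf_nat n (b x : R) : 0 < b -> 0 < x ->
  gamma_pdf n.+1%:R b x = b * poi (b * x) n.
Proof.
move=> b0 x0; rewrite /gamma_pdf x0 Gamma_nat -natr1 addrK natr1.
rewrite !powR_mulrn ?(ltW b0) ?(ltW x0)// /poi /exp_coeff/= exprMn exprS mulNr.
by ring.
Qed.

Lemma measurable_scaled_poi (D : set R) n (b : R) :
  measurable_fun D (fun x => (b * poi (b * x) n)%:E).
Proof.
apply/measurable_EFinP; apply: measurable_funTS; apply: measurable_funM => //.
apply: (measurableT_comp (f := poi^~ n)); last exact: measurable_funM.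
by apply: continuous_measurable_fun; exact: continuous_poi.
Qed.

(** The probability that an Erlang variable of shape [k] exceeds [s]. Shape 0 stands for the
    constant 0, the empty sum, which exceeds exactly the negative levels. *)
Definition erlang_tail (k : nat) (b s : R) : R :=
  if 0 <= s then poi_sum k (b * s) else 1.

Lemma erlang_tail_ge0 k b s : 0 < b -> 0 <= erlang_tail k b s.
Proof.
move=> b0; rewrite /erlang_tail; case: ifP => // s0.
by apply: poi_sum_ge0; rewrite mulr_ge0// ltW.
Qed.

Lemma measurable_erlang_tail k b : measurable_fun setT (erlang_tail k b).
Proof.
apply: measurable_fun_if => //.
- by apply: measurable_fun_ler.
- apply: measurable_funTS.
  apply: (measurableT_comp (f := poi_sum k)); last exact: measurable_funM.
  apply: measurable_sum => i.
  by apply: continuous_measurable_fun; exact: continuous_poi.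
Qed.

Lemma integral_scaled_poi_oy n (b x : R) : 0 < b -> 0 <= x ->
  (\int[mu]_(u in `]x, +oo[) (b * poi (b * u) n)%:E = (poi_sum n.+1 (b * x))%:E)%E.
Proof.
move=> b0 x0.
rewrite (@integral_itv_obnd_cbnd _ _ +oo%O)//; last exact: measurable_scaled_poi.
exact: integral_poi_itvcy.
Qed.

Lemma poi_sum0 n : poi_sum n.+1 0 = 1 :> R.
Proof. by rewrite /poi_sum big_ord_recl poi0 big1 ?addr0// => i _; rewrite poi0. Qed.

(** Condition on an added Erlang variable of shape [n + 1] with value [x]. For [x > s] the first
    factor is 1 and the tail of the added variable remains, giving the first [n + 1] weights; for
    [x <= s] the convolution shifts each of the [k] weights by [n + 1]. *)
Lemma erlang_tail_conv k n b s : 0 < b ->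
  (\int[mu]_(x in `]0%R, +oo[)
     ((erlang_tail k b (s - x))%:E * (b * poi (b * x) n)%:E) =
   (erlang_tail (k + n.+1) b s)%:E)%E.
Proof.
move=> b0.
have mtail (D : set R) : measurable_fun D (fun x => (erlang_tail k b (s - x))%:E).
  apply/measurable_EFinP; apply: measurable_funTS.
  apply: (measurableT_comp (f := erlang_tail k b)).
    exact: measurable_erlang_tail.
  exact: measurable_funB.
have mprod (D : set R) : measurable_fun D (fun x =>
    (erlang_tail k b (s - x))%:E * (b * poi (b * x) n)%:E)%E.
  apply: emeasurable_funM; first exact: mtail.
  exact: measurable_scaled_poi.
have [s0|s0] := ltP s 0.
  rewrite [in RHS]/erlang_tail leNgt s0/=.
  rewrite -[in RHS](poi_sum0 n) -[in RHS](mulr0 b) -integral_scaled_poi_oy//.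
  apply: eq_integral => x; rewrite inE/= in_itv/= andbT => x0.
  by rewrite /erlang_tail leNgt subr_lt0 (lt_trans s0 x0) mul1e.
rewrite (@integral_itv_obnd_cbnd _ _ +oo%O)//.
have -> : `[0%R, +oo[%classic = `[0%R, s] `|` `]s, +oo[ :> set R.
  by rewrite -itv_bndbnd_setU.
rewrite ge0_integral_setU//=; last 3 first.
- exact: mprod.
- move=> x; rewrite !in_itv/= => xs.
  rewrite -EFinM lee_fin mulr_ge0 ?erlang_tail_ge0// mulr_ge0 ?(ltW b0)// poi_ge0//.
  rewrite mulr_ge0 ?(ltW b0)//.
  by case: xs => [/andP[]//|/andP[/ltW sx _]]; exact: le_trans sx.
- apply/disj_setPS => x [/=]; rewrite !in_itv/= andbT => /andP[_ xs] sx.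
  by move: (le_lt_trans xs sx); rewrite ltxx.
transitivity ((\sum_(i < k) poi (b * s) (i + n.+1))%:E +
   (poi_sum n.+1 (b * s))%:E)%E; last first.
  rewrite -EFinD /erlang_tail s0 addrC addnC /poi_sum big_split_ord/=; congr (_ + _)%:E.
  by apply: eq_bigr => i _; rewrite addnC.
congr (_ + _)%E.
  transitivity (\int[mu]_(x in `[0%R, s])
      \sum_(i < k) (poi (b * (s - x)) i * (b * poi (b * x) n))%:E)%E.
    apply: eq_integral => x; rewrite inE/= in_itv/= => /andP[x0 xs].
    by rewrite /erlang_tail subr_ge0 xs sumEFin -mulr_suml -EFinM.
  rewrite ge0_integral_sum//.
  - by rewrite -sumEFin; apply: eq_bigr => i _; rewrite integral_poi_conv.
  - move=> i; apply/measurable_EFinP; apply: measurable_funM; last first.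
      by have /measurable_EFinP := @measurable_scaled_poi `[0%R, s]%classic n b.
    apply: measurable_funTS; apply: (measurableT_comp (f := poi^~ i)).
      by apply: continuous_measurable_fun; exact: continuous_poi.
    by apply: measurable_funM => //; exact: measurable_funB.
  - move=> i x; rewrite /= in_itv/= => /andP[x0 xs].
    have b0' := ltW b0.
    have sx0 : 0 <= s - x by rewrite subr_ge0.
    by rewrite lee_fin; apply: mulr_ge0; [|apply: mulr_ge0 => //]; apply: poi_ge0; apply: mulr_ge0.
rewrite -integral_scaled_poi_oy//; apply: eq_integral => x; rewrite inE/= in_itv/= andbT => x0.
by rewrite /erlang_tail leNgt subr_lt0 x0 mul1e.
Qed.

End gamma_sums.

(** * The law of the partial sums of the jumps *)

Section gamma_sum_law.
Context d (T : measurableType d) (R : realType) (P : probability T R).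
Notation mu := (@lebesgue_measure R).
Variables (n : nat) (b : R) (G : nat -> T -> R).
Hypothesis b0 : 0 < b.
Hypothesis gammaG : forall j, gamma_distributed P n.+1%:R b (G j).
Hypothesis indepG : mutually_independent P (fun j => salgebra_of (G j)).

Let mG j : measurable_fun setT (G j). Proof. by have [] := gammaG j. Qed.

Let mG' j (B : set R) : measurable B -> measurable (G j @^-1` B).
Proof. by move=> mB; rewrite -[X in measurable X]setTI; exact: mG. Qed.

Let pos : set R := `]0, +oo[%classic.

Let mpos : measurable pos. Proof. exact: measurable_itv. Qed.

Lemma gamma_law j (B : set R) : measurable B ->
  (P (G j @^-1` (pos `&` B)) =
   \int[mu]_(x in pos `&` B) (b * poi (b * x) n)%:E)%E.
Proof.
move=> mB; have [_ ->] := gammaG j; last exact: measurableI.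
apply: eq_integral => x; rewrite inE => -[+ _]; rewrite /pos/= in_itv/= andbT => x0.
by rewrite gamma_pdf_nat.
Qed.

Lemma gamma_pos j : P (G j @^-1` (~` pos)) = 0%E.
Proof.
have [_ ->] := gammaG j; last exact: measurableC.
apply: integral0_eq => x; rewrite /pos/= in_itv/= andbT => /negP.
by rewrite /gamma_pdf => /negbTE ->.
Qed.

(** Restricts events to positive values of [G j], where the gamma density is a scaled Poisson
    weight. *)
Lemma gammaI_pos j (A : set T) : measurable A ->
  P A = P (A `&` G j @^-1` pos).
Proof.
move=> mA; rewrite (measureDI P mA (mG' j mpos)).
rewrite [X in (X + _)%E](_ : _ = 0%E) ?add0e//.
apply: (subset_measure0 _ _ _ (gamma_pos j)) => //.
- by apply: measurableD => //; apply: mG'; exact: mpos.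
- by apply: mG'; exact: measurableC.
Qed.

Let partial_sum m w : R := \sum_(j < m) G j w.

Let mpartial_sum m : measurable_fun setT (partial_sum m).
Proof. by apply: measurable_sum => j; exact: mG. Qed.

Let cylinder (J : seq nat) (B : nat -> set R) : set T :=
  \bigcap_(j in [set` J]) G j @^-1` B j.

Let mcylinder J B : (forall j, measurable (B j)) -> measurable (cylinder J B).
Proof.
move=> mB; apply: fin_bigcap_measurable; first exact: finite_seq.
by move=> j _; exact: mG'.
Qed.

Let cylinderE J B : uniq J -> (forall j, measurable (B j)) ->
  P (cylinder J B) = (\prod_(j <- J) fine (P (G j @^-1` B j)))%:E.
Proof.
move=> uJ mB; apply: indepG => // j _.
by exists (B j) => //; rewrite setTI.
Qed.

(* Carrying a cylinder in the later variables through the induction gives the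
   independence of the partial sums from them without a Dynkin argument. *)
Lemma gamma_sum_tail_cylinder m J B s : uniq J -> (forall j, j \in J -> (m <= j)%N) ->
  (forall j, measurable (B j)) ->
  (P ([set w | (s < partial_sum m w)%R] `&` cylinder J B) =
   (erlang_tail (m * n.+1) b s)%:E * P (cylinder J B))%E.
Proof.
elim: m J B s => [|m ih] J B s uJ mJ mB.
  rewrite mul0n /erlang_tail; have [s0|s0] := ltP s 0.
    rewrite mul1e; congr (P _); apply/seteqP; split => [w []//|w Cw]; split => //=.
    by rewrite /partial_sum big_ord0.
  rewrite /poi_sum big_ord0 mul0e (_ : _ `&` _ = set0) ?measure0//.
  apply/seteqP; split => // w [] /=; rewrite /partial_sum big_ord0.
  by rewrite ltNge s0.
have mNJ : m \notin J by apply/negP => /mJ; rewrite ltnn.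
have mJ' j : j \in J -> (m <= j)%N by move=> /mJ/ltnW.
(* The event for [m + 1] terms with the last term frozen at [x]. *)
pose E x := [set w | (s - x < partial_sum m w)%R] `&` cylinder J B.
have mE x : measurable (E x).
  apply: measurableI; last exact: mcylinder.
  by rewrite -[X in measurable X]setTI; apply: measurable_fun_ltr.
have PE x : P (E x) = ((erlang_tail (m * n.+1) b (s - x))%:E * P (cylinder J B))%E.
  exact: ih.
have fE x : pos x -> (0 <= (b * poi (b * x) n)%:E)%E.
  rewrite /pos/= in_itv/= andbT => x0.
  by rewrite lee_fin mulr_ge0 ?(ltW b0)// poi_ge0// mulr_ge0 ?ltW.
have [|||||||||||mfrz mPE frz] := @probability_freezing _ T R P (G m) pos
    (fun x => (b * poi (b * x) n)%:E) E (@floor_index R)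
    (fun l j => j%:R / l.+1%:R).
- exact: mG.
- exact: measurable_itv.
- exact: measurable_scaled_poi.
- exact: fE.
- by [].
- by rewrite integral_scaled_poi_oy// ltry.
- exact: measurable_floor_index.
- move=> l j; apply: gamma_law.
  by rewrite -[X in measurable X]setTI; exact: measurable_floor_index.
- exact: mE.
- move=> l j; set cell := pos `&` _; set c := _ / _.
  have mcell : measurable cell.
    apply: measurableI => //.
    by rewrite -[X in measurable X]setTI; exact: measurable_floor_index.
  (* The condition on [G m] becomes one more coordinate of the cylinder. As the indices are only
     required to be at least [m], the induction hypothesis applies to [m :: J] and separates the
     cell from the partial sum. *)
  pose B' i := if i == m then cell else B i.
  have mB' i : measurable (B' i) by rewrite /B'; case: ifP.
  have uJ' : uniq (m :: J) by rewrite /= mNJ.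
  have eqB' i : i \in J -> B' i = B i.
    by move=> iJ; rewrite /B'; case: eqP => // im; rewrite -im iJ in mNJ.
  have CE : cylinder (m :: J) B' = G m @^-1` cell `&` cylinder J B.
    apply/seteqP; split => w.
      move=> H; split.
        by have := H m; rewrite /B' eqxx; apply; rewrite /= mem_head.
      move=> i /= iJ; have := H i; rewrite eqB'//; apply.
      by rewrite /= in_cons iJ orbT.
    move=> [H1 H2] i /=; rewrite in_cons => /predU1P[->|iJ].
      by rewrite /B' eqxx.
    by rewrite eqB'//; exact: H2.
  have PC : P (cylinder (m :: J) B') = (P (G m @^-1` cell) * P (cylinder J B))%E.
    rewrite !cylinderE// big_cons EFinM {1}/B' eqxx fineK; last first.
      by apply: fin_num_measure; exact: mG'.
    by congr (_ * _%:E)%E; apply: eq_big_seq => i iJ; rewrite eqB'.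
  rewrite PE muleCA -PC -ih//; last first.
    by move=> i; rewrite in_cons => /predU1P[->//|]; exact: mJ'.
  by rewrite CE setICA.
- move=> x; rewrite /pos/= in_itv/= andbT => x0 w.
  have [sx|sx] := ltP (s - x) (partial_sum m w); last first.
    apply: nearW => l; split=> -[/= + Cw]; last by rewrite ltNge sx.
    rewrite ltNge => /negP; case; apply: (le_trans sx).
    rewrite lerD2l lerN2.
    by have /andP[] := floor_index_le l (ltW x0).
  have e0 : 0 < partial_sum m w - (s - x) by rewrite subr_gt0.
  near=> l; split=> -[/= _ Cw]; split => //=.
  have /andP[_ xl] := floor_index_le l (ltW x0).
  have : l.+1%:R^-1 < partial_sum m w - (s - x) by near: l; exact: near_infty_natSinv_lt (PosNum e0).
  rewrite ltrBrDr => lp; apply: lt_trans lp.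
  by rewrite [ltRHS]addrCA ltrD2l ltrNl opprB ltrBlDr.
have -> : [set w | s < partial_sum m.+1 w] `&` cylinder J B =
    [set w | E (G m w) w].
  apply/seteqP; split => w [/= + Cw].
    by rewrite /partial_sum big_ord_recr/= => sG; split => //=; rewrite ltrBlDr.
  by rewrite ltrBlDr => sG; split => //=; rewrite /partial_sum big_ord_recr.
have mEG : measurable [set w | E (G m w) w].
  apply: measurableI; last exact: mcylinder.
  rewrite -[X in measurable X]setTI; apply: measurable_fun_ltr => //.
  by apply: measurable_funB.
rewrite (gammaI_pos m mEG) setIC.
transitivity (P [set w | pos (G m w) /\ E (G m w) w]); first by [].
rewrite frz.
under eq_integral do rewrite PE -muleA muleCA.
rewrite ge0_integralZl//.
- by rewrite erlang_tail_conv// mulSnr muleC.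
- apply: emeasurable_funM; last exact: measurable_scaled_poi.
  apply/measurable_EFinP; apply: measurable_funTS.
  apply: (measurableT_comp (f := erlang_tail (m * n.+1) b)).
    exact: measurable_erlang_tail.
  exact: measurable_funB.
- by move=> x /fE; apply: mule_ge0; rewrite lee_fin erlang_tail_ge0.
Unshelve. all: end_near. Qed.

Lemma gamma_sum_tail m s :
  P [set w | s < \sum_(j < m) G j w] = (erlang_tail (m * n.+1) b s)%:E.
Proof.
have := @gamma_sum_tail_cylinder m [::] (fun=> setT) s isT.
have -> : cylinder [::] (fun=> setT) = setT.
  by apply/seteqP; split.
by rewrite probability_setT mule1 setIT; apply.
Qed.

End gamma_sum_law.

(** * The density of the inverse process *)

Section inverse_density.
Context {R : realType}.
Notation mu := (@lebesgue_measure R).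
Implicit Types x u : R.

Lemma measurable_nneseries (D : set R) (h : nat -> R -> \bar R) :
  (forall k x, D x -> (0 <= h k x)%E) -> (forall k, measurable_fun D (h k)) ->
  measurable_fun D (fun x => \sum_(k <oo) h k x)%E.
Proof.
move=> h0 mh; have := @ge0_emeasurable_sum _ _ R D h xpredT.
by apply => [k x Dx _|k _]; [exact: h0|exact: mh].
Qed.

Lemma nneseries_lt (f : nat -> \bar R) m :
  (\sum_(k <oo) (if (k < m)%N then f k else 0) = \sum_(k < m) f k)%E.
Proof.
apply: lim_near_cst => //; near=> N.
rewrite -big_mkcond/= -(big_mkord xpredT) (@big_nat_widen _ _ _ 0 m N)//.
by near: N; exact: nbhs_infty_ge.
Unshelve. all: end_near. Qed.

Variables (n : nat) (b l t : R).
Hypothesis b0 : 0 < b.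
Hypothesis l0 : 0 < l.
Hypothesis t0 : 0 <= t.

Let bt0 : 0 <= b * t. Proof. by rewrite mulr_ge0// ltW. Qed.

(* The probability that the jump number [m + 1] crosses the level [t]. *)
Definition crossing m : R := \sum_(i < n.+1) poi (b * t) (m * n.+1 + i).

Lemma crossing_ge0 m : 0 <= crossing m.
Proof. by apply: sumr_ge0 => i _; exact: poi_ge0. Qed.

Lemma sum_crossing M : \sum_(m < M) crossing m = poi_sum (M * n.+1) (b * t).
Proof.
elim: M => [|M ih]; first by rewrite mul0n /poi_sum !big_ord0.
by rewrite big_ord_recr/= ih mulSnr /poi_sum big_split_ord.
Qed.

Definition inverse_density u : \bar R :=
  (\sum_(m <oo) (crossing m * (l * poi (l * u) m))%:E)%E.

Let term_ge0 m u : 0 <= u -> (0 <= (crossing m * (l * poi (l * u) m))%:E)%E.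
Proof.
move=> u0; rewrite lee_fin mulr_ge0 ?crossing_ge0// mulr_ge0 ?(ltW l0)//.
by rewrite poi_ge0// mulr_ge0 ?(ltW l0).
Qed.

Lemma inverse_density_ge0 u : 0 <= u -> (0 <= inverse_density u)%E.
Proof. by move=> u0; apply: nneseries_ge0 => m _ _; exact: term_ge0. Qed.

Let mterm (D : set R) m :
  measurable_fun D (fun u => (crossing m * (l * poi (l * u) m))%:E).
Proof.
apply/measurable_EFinP; apply: measurable_funM => //.
by have /measurable_EFinP := @measurable_scaled_poi R D m l.
Qed.

Let nneg_subset (D : set R) x : D `<=` `[0%R, +oo[ -> D x -> 0 <= x.
Proof. by move=> /[apply]/=; rewrite in_itv/= andbT. Qed.

Lemma measurable_inverse_density (D : set R) : D `<=` `[0%R, +oo[ ->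
  measurable_fun D inverse_density.
Proof.
move=> D0; apply: measurable_nneseries => [k x Dx|k]; last exact: mterm.
by apply: term_ge0; exact: nneg_subset Dx.
Qed.

Lemma integral_inverse_density (D : set R) : measurable D -> D `<=` `[0%R, +oo[ ->
  (\int[mu]_(u in D) inverse_density u =
   \sum_(m <oo) (crossing m)%:E * \int[mu]_(u in D) (l * poi (l * u) m)%:E)%E.
Proof.
move=> mD D0; rewrite integral_nneseries//; last 2 first.
- by move=> m; exact: mterm.
- by move=> m u Du; apply: term_ge0; exact: nneg_subset Du.
apply: eq_eseriesr => m _; under eq_integral do rewrite EFinM.
rewrite ge0_integralZl//.
- exact: measurable_scaled_poi.
- move=> u /(nneg_subset D0) u0; rewrite lee_fin mulr_ge0 ?(ltW l0)//.
  by rewrite poi_ge0// mulr_ge0 ?(ltW l0).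
- by rewrite lee_fin crossing_ge0.
Qed.

Lemma integral_inverse_density_itvcc x : 0 <= x ->
  (\int[mu]_(u in `[0%R, x]) inverse_density u =
   \sum_(m <oo) (crossing m * (1 - poi_sum m.+1 (l * x)))%:E)%E.
Proof.
move=> x0; rewrite integral_inverse_density//; last first.
  by move=> u/=; rewrite !in_itv/= => /andP[->].
by apply: eq_eseriesr => m _; rewrite integral_poi_itvcc.
Qed.

Lemma nneseries_crossing_le1 : (\sum_(m <oo) (crossing m)%:E <= 1)%E.
Proof.
apply: lime_le.
  by apply: is_cvg_nneseries => m _ _; rewrite lee_fin crossing_ge0.
apply: nearW => M; rewrite sumEFin big_mkord sum_crossing lee_fin.
exact: poi_sum_le1.
Qed.

Lemma integral_inverse_density_lty :
  (\int[mu]_(u in `[0%R, +oo[) inverse_density u < +oo)%E.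
Proof.
rewrite integral_inverse_density//.
apply: (@le_lt_trans _ _ 1%E); last exact: ltry.
rewrite (le_trans _ nneseries_crossing_le1)//.
rewrite (eq_eseriesr (g := fun m => (crossing m)%:E))//.
by move=> m _; rewrite integral_poi_itvcy// mulr0 poi_sum0 mule1.
Qed.

(** Each [crossing m] is at most 1, so the density is bounded by [l] times the total Poisson
    mass. *)
Lemma inverse_density_fin_num u : 0 <= u -> inverse_density u \is a fin_num.
Proof.
move=> u0; rewrite ge0_fin_numE ?inverse_density_ge0//.
apply: (@le_lt_trans _ _ (\sum_(m <oo) (l%:E * (poi (l * u) m)%:E))%E).
  apply: lee_nneseries => [m _ _|m _]; first exact: term_ge0.
  have lu0 : 0 <= l * u by rewrite mulr_ge0// ltW.
  have p0 : 0 <= l * poi (l * u) m by rewrite mulr_ge0 ?(ltW l0)// poi_ge0.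
  rewrite -EFinM lee_fin ler_piMl//.
  rewrite (le_trans _ (poi_sum_le1 (m.+1 * n.+1) bt0))// -sum_crossing.
  by rewrite big_ord_recr/= lerDr sumr_ge0// => i _; exact: crossing_ge0.
rewrite nneseriesZl; last first.
  by move=> m _; rewrite lee_fin poi_ge0// mulr_ge0// ltW.
by rewrite nneseries_poi ?mulr_ge0 ?(ltW l0)// mule1 ltry.
Qed.

(** Both sides compute the probability that the level is passed by time [x]: the left one conditions
    on the number [m] of jumps up to [x], the right one on the index [k] of the crossing jump.
    Interchanging the sums over pairs [k < m] turns one into the other. *)
Lemma mixed_poi_sum x : 0 <= x ->
  (\sum_(m <oo) (poi (l * x) m * poi_sum (m * n.+1) (b * t))%:E =
   \int[mu]_(u in `[0%R, x]) inverse_density u)%E.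
Proof.
move=> x0; rewrite integral_inverse_density_itvcc//.
have lx0 : 0 <= l * x by rewrite mulr_ge0// ltW.
pose a m k : \bar R := if (k < m)%N then (poi (l * x) m * crossing k)%:E else 0%E.
have a0 m k : (0 <= a m k)%E.
  by rewrite /a; case: ifP => // _; rewrite lee_fin mulr_ge0 ?poi_ge0 ?crossing_ge0.
transitivity (\sum_(m <oo) \sum_(k <oo) a m k)%E.
  apply: eq_eseriesr => m _; rewrite nneseries_lt sumEFin -mulr_sumr.
  by rewrite sum_crossing.
rewrite nneseries_interchange//; apply: eq_eseriesr => k _.
rewrite EFinM -nneseries_poi_tail// -nneseriesZl; last first.
  by move=> m _; rewrite lee_fin poi_ge0.
rewrite [RHS]eseries_cond [RHS]eseries_mkcond; apply: eq_eseriesr => m _.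
by rewrite /a; case: ifP => // _; rewrite mulrC.
Qed.

(** Serves to show that the level is passed almost surely. The truncated integrals will be
    probabilities of having passed by time [x], and [a] a common bound for them. *)
Lemma inverse_density_mass_ge1 (a : R) :
  (forall x, 0 <= x -> (\int[mu]_(u in `[0%R, x]) inverse_density u <= a%:E)%E) ->
  1 <= a.
Proof.
move=> ha.
have partial M : poi_sum (M * n.+1) (b * t) <= a.
  rewrite -sum_crossing.
  have cv : \sum_(m < M) crossing m * (1 - poi_sum m.+1 (l * x)) @[x --> +oo] -->
      \sum_(m < M) crossing m.
    elim: M => [|M ih].
      by under eq_fun do rewrite big_ord0; rewrite big_ord0; exact: cvg_cst.
    rewrite big_ord_recr/=.
    have -> : (fun x => \sum_(m < M.+1) crossing m * (1 - poi_sum m.+1 (l * x))) =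
      (fun x => \sum_(m < M) crossing m * (1 - poi_sum m.+1 (l * x)) +
         crossing M * (1 - poi_sum M.+1 (l * x))).
      by apply/funext => x; rewrite big_ord_recr.
    apply: cvgD => //; rewrite -[X in _ --> X]mulr1.
    apply: cvgM; first exact: cvg_cst.
    rewrite -[X in _ --> X](subr0 (1 : R)).
    by apply: cvgB; [exact: cvg_cst|exact: poi_sum_cvg0].
  apply: (cvgr_to_le cv); near=> x.
  have x0 : 0 <= x by near: x; exact: nbhs_pinfty_ge.
  rewrite -lee_fin (le_trans _ (ha _ x0))// integral_inverse_density_itvcc//.
  rewrite -sumEFin.
  have := @nneseries_lim_ge R (fun m => (crossing m * (1 - poi_sum m.+1 (l * x)))%:E) xpredT 0 M.
  rewrite big_mkord; apply => m _ _.
  by rewrite lee_fin mulr_ge0 ?crossing_ge0// subr_ge0 poi_sum_le1// mulr_ge0// ltW.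
(* A sum of arbitrary length [k] is dominated by the one of length [k * n.+1], which ends with a
   complete block. *)
have poi_sumS k : poi_sum k (b * t) <= a.
  rewrite (le_trans _ (partial k))// /poi_sum mulnSr addnC big_split_ord/=.
  by rewrite lerDl sumr_ge0// => i _; exact: poi_ge0.
rewrite -lee_fin -(nneseries_poi bt0); apply: lime_le.
  by apply: is_cvg_nneseries => m _ _; rewrite lee_fin poi_ge0.
by apply: nearW => M; rewrite sumEFin big_mkord lee_fin; exact: poi_sumS.
Unshelve. all: end_near. Qed.

End inverse_density.

(** * The law of the inverse process *)

Section independence_lemmas.
Context d (T : measurableType d) (R : realType) (P : probability T R).

Lemma mutually_independent2 (A1 A2 : set (set T)) (a1 a2 : set T) :
  mutually_independent P (tnth [tuple A1; A2]) ->
  A1 a1 -> A2 a2 -> measurable a1 -> measurable a2 ->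
  P (a1 `&` a2) = (P a1 * P a2)%E.
Proof.
move=> indep A1a1 A2a2 m1 m2.
pose A (i : 'I_2) := if i == ord0 then a1 else a2.
have AE : \bigcap_(i in [set` [:: ord0; ord_max]]) A i = a1 `&` a2.
  apply/seteqP; split => w.
    by move=> H; split; [apply: (H ord0)|apply: (H ord_max)]; rewrite /= !inE eqxx ?orbT.
  by move=> [w1 w2] i /=; rewrite !inE => /orP[]/eqP ->.
rewrite -AE indep//; last first.
  by move=> i; rewrite !inE => /orP[]/eqP ->.
by rewrite big_cons big_seq1 EFinM !fineK ?fin_num_measure.
Qed.

Lemma mutually_independent3 (A1 A2 A3 : set (set T)) (a1 a2 a3 : set T) :
  mutually_independent P (tnth [tuple A1; A2; A3]) ->
  A1 a1 -> A2 a2 -> A3 a3 -> measurable a1 -> measurable a2 -> measurable a3 ->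
  (P (a1 `&` a2 `&` a3) = P a1 * P a2 * P a3)%E.
Proof.
move=> indep A1a1 A2a2 A3a3 m1 m2 m3.
pose A (i : 'I_3) := tnth [tuple a1; a2; a3] i.
pose i1 : 'I_3 := Ordinal (isT : 1 < 3)%N.
have AE : \bigcap_(i in [set` [:: ord0; i1; ord_max]]) A i = a1 `&` a2 `&` a3.
  apply/seteqP; split => w.
    move=> H; split; first split.
    - by apply: (H ord0); rewrite /= !inE eqxx.
    - by apply: (H i1); rewrite /= !inE eqxx ?orbT.
    - by apply: (H ord_max); rewrite /= !inE eqxx ?orbT.
  by move=> [[w1 w2] w3] i /=; rewrite !inE => /or3P[]/eqP ->.
rewrite -AE indep//; last first.
  by move=> i; rewrite !inE => /or3P[]/eqP ->.
by rewrite !big_cons big_nil mulr1 !EFinM !fineK ?fin_num_measure// muleA.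
Qed.

Lemma salgebra_of_familyP d' (T' : measurableType d') (I : Type) (D : set I)
    (X : I -> T -> T') i (B : set T') : D i -> measurable B ->
  salgebra_of_family D X (X i @^-1` B).
Proof.
move=> Di mB; apply: sub_sigma_algebra; exists i => //.
by exists B => //; rewrite setTI.
Qed.

Lemma salgebra_of_family_partial_sum (G : nat -> T -> R) m (s : R) :
  salgebra_of_family [set: nat] G [set w | s < \sum_(j < m) G j w].
Proof.
pose S := \bigcup_(i in [set: nat]) salgebra_of (G i).
(* The claim is membership in the sigma-algebra generated by the [G i], so [T] is equipped with that
   one and the usual closure of measurable functions under sums applies. *)
have mG j : @measurable_fun _ _ (g_sigma_algebraType S) R setT (G j).
  move=> _ B mB; rewrite setTI.
  exact: (@salgebra_of_familyP _ _ _ setT G).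
have mS : @measurable_fun _ _ (g_sigma_algebraType S) R setT
    (fun w => \sum_(j < m) G j w).
  by apply: measurable_sum => j; exact: mG.
have := @measurable_fun_ltr _ (g_sigma_algebraType S) R setT (cst s) _ (measurable_cst _) mS.
move=> /(_ measurableT [set true] _) ; rewrite setTI; exact.
Qed.

End independence_lemmas.

(** * Marginals and paths of a Poisson process *)

Section poisson_process_lemmas.
Context d (T : measurableType d) (R : realType) (P : probability T R).
Variables (l : R) (N : R -> T -> nat).
Hypothesis l0 : 0 < l.
Hypothesis poissonN : poisson_process P l N.

Lemma poisson_process_measurable_preimage x (B : set nat) : 0 <= x ->
  measurable (N x @^-1` B).
Proof.
move=> x0; rewrite -[X in measurable X]setTI.
exact: (poisson_process_measurable poissonN).
Qed.

Lemma poisson_process_marginal x k : 0 <= x ->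
  P [set w | N x w = k] = (poi (l * x) k)%:E.
Proof.
rewrite le_eqVlt => /predU1P[<-|x0].
  rewrite mulr0 poi0; have N0 := poisson_process_start poissonN.
  case: eqP => [->|/eqP k0].
    rewrite (_ : [set w | _] = setT) ?probability_setT//.
    by apply/seteqP; split => // w _; exact: N0.
  rewrite (_ : [set w | _] = set0) ?measure0//.
  by apply/seteqP; split => // w /=; rewrite N0 => k0'; rewrite -k0' eqxx in k0.
rewrite -poisson_pmfE ?mulr_gt0//.
have := poisson_process_increment poissonN k (lexx 0) x0.
rewrite subr0 => <-; congr (P _); apply/seteqP; split => w /=;
  by rewrite (poisson_process_start poissonN) subn0.
Qed.

(** Convergence in the discrete space of naturals is eventual equality, so right-continuity means
    constancy on a short interval to the right. *)
Lemma poisson_process_locally_constant w x : 0 <= x ->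
  exists2 e : R, 0 < e & forall s, x <= s -> s < x + e -> N s w = N x w.
Proof.
move=> x0; have : N s w @[s --> x^'+] --> N x w.
  exact: (poisson_process_right_continuous poissonN).
move=> /discrete_cvg.
rewrite /nbhs/= /fmap/= /at_right => /nbhs_ballP[e /= e0 xe].
exists e => // s; rewrite le_eqVlt => /predU1P[<-//|xs] sxe.
apply: xe => //; rewrite /ball/= ltr0_norm ?subr_lt0// opprB.
by rewrite ltrBlDl.
Qed.

End poisson_process_lemmas.

(** * The inverse process: measurability, null events and distribution function *)

Section inverse_law.
Context d (T : measurableType d) (R : realType) (P : probability T R).
Notation mu := (@lebesgue_measure R).
Variables (n : nat) (l b t : R) (X : R -> T -> R).
Variables (N : R -> T -> nat) (G : nat -> T -> R).
Hypotheses (l0 : 0 < l) (b0 : 0 < b) (t0 : 0 <= t).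
Hypothesis poissonN : poisson_process P l N.
Hypothesis gammaG : forall j, gamma_distributed P n.+1%:R b (G j).
Hypothesis indepG : mutually_independent P (fun j => salgebra_of (G j)).
Hypothesis indepNG : mutually_independent P
  (tnth [tuple salgebra_of_process N; salgebra_of_family [set: nat] G]).
Hypothesis XE : forall x w, 0 <= x -> X x w = \sum_(j < N x w) G j w.

Let Y := inverse_process X t.

Let Yset w : set R := [set u | 0 <= u /\ t < X u w].

Let mG j : measurable_fun setT (G j). Proof. by have [] := gammaG j. Qed.

Let passed x : set T := [set w | t < X x w].

Let passedE x : 0 <= x -> passed x =
  \bigcup_m ([set w | N x w = m] `&` [set w | t < \sum_(j < m) G j w]).
Proof.
move=> x0; apply/seteqP; split => w.
  by rewrite /passed/= XE// => tX; exists (N x w).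
by move=> [m _ [/= Nm tG]]; rewrite /passed/= XE// Nm.
Qed.

Let mN x m : 0 <= x -> measurable [set w | N x w = m].
Proof. exact: (poisson_process_measurable_preimage poissonN [set m]). Qed.

Let mgamma_sum m : measurable [set w | t < \sum_(j < m) G j w].
Proof.
rewrite -[X in measurable X]setTI; apply: measurable_fun_ltr => //.
by apply: measurable_sum => j; exact: mG.
Qed.

Let mpassed x : 0 <= x -> measurable (passed x).
Proof.
move=> x0; rewrite passedE//; apply: bigcupT_measurable => m.
by apply: measurableI; [exact: mN|exact: mgamma_sum].
Qed.

Let P_passed x : 0 <= x ->
  P (passed x) = (\int[mu]_(u in `[0%R, x]) inverse_density n b l t u)%E.
Proof.
move=> x0; rewrite -mixed_poi_sum// passedE// measure_semi_bigcup//; last 3 first.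
- by move=> m; apply: measurableI; [exact: mN|exact: mgamma_sum].
- by move=> i j _ _ [w [[/= <- _] [/= <- _]]].
- by apply: bigcupT_measurable => m; apply: measurableI; [exact: mN|exact: mgamma_sum].
apply: eq_eseriesr => m _.
transitivity (P [set w | N x w = m] *
    P [set w | (t < \sum_(j < m) G j w)%R])%E; last first.
  rewrite (poisson_process_marginal l0 poissonN)// (gamma_sum_tail b0 gammaG indepG).
  by rewrite -EFinM /erlang_tail t0.
apply: (mutually_independent2 indepNG) => //.
- exact: (@salgebra_of_familyP _ _ _ _ _ [set t | 0 <= t] N x [set m]).
- exact: salgebra_of_family_partial_sum.
- exact: mN.
Qed.

Let X_locally_constant w x : 0 <= x ->
  exists2 e : R, 0 < e & forall s, x <= s -> s < x + e -> X s w = X x w.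
Proof.
move=> x0; have [e e0 Ne] := poisson_process_locally_constant poissonN w x0.
exists e => // s xs sx; rewrite !XE ?(le_trans x0)//.
by rewrite Ne.
Qed.

Let Yset_lb w : lbound (Yset w) 0. Proof. by move=> u []. Qed.

Lemma inverse_process_ge0 w : 0 <= Y w.
Proof.
have [[u Yu]|/set0P/negP/negPn/eqP Y0] := pselect (Yset w !=set0).
  by apply: lb_le_inf; [exists u|exact: Yset_lb].
by rewrite /Y /inverse_process -/(Yset w) Y0 inf0.
Qed.

Let Y_le x w : 0 <= x -> passed x w -> Y w <= x.
Proof. by move=> x0 tX; apply: ge_inf; [exists 0; exact: Yset_lb|]. Qed.

(* Right-continuity of the paths lets rational times suffice. *)
Let Yset_rat w u (x : R) : Yset w u -> u < x ->
  exists q : rat, [/\ 0 <= ratr q :> R, ratr q < x & passed (ratr q) w].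
Proof.
move=> [u0 tX] ux; have [e e0 Xe] := X_locally_constant w u0.
have : u < Num.min x (u + e) by rewrite lt_min ux ltrDl.
move=> /rat_in_itvoo[q]; rewrite in_itv/= lt_min => /and3P[uq qx que].
exists q; split => //; first by rewrite (le_trans u0)// ltW.
by rewrite /passed/= Xe// ltW.
Qed.

(** The event that the level is never passed, on which the infimum defaults to 0. Rational times
    make it measurable. *)
Let never : set T := ~` \bigcup_(q : rat)
  (if 0 <= ratr q :> R then passed (ratr q) else set0).

Let mnever : measurable never.
Proof.
apply: measurableC; apply: bigcupT_measurable_rat => q.
by case: ifPn => // q0; exact: mpassed.
Qed.

Let neverP w : never w <-> Yset w = set0.
Proof.
split=> [nw|Y0 [q _]].
  apply/seteqP; split => // u Yu; apply: nw.
  have [q [q0 _ pq]] := Yset_rat Yu (ltr_pwDr ltr01 (lexx u)).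
  by exists q => //; rewrite q0.
case: ifPn => // q0 pq.
suff : Yset w (ratr q) by rewrite Y0.
by split.
Qed.

Lemma measurable_inverse_process : measurable_fun setT Y.
Proof.
move=> mT; apply: (measurability _ (RGenInftyO.measurableE R)) => //.
move=> _ [_ [x ->] <-]; rewrite setTI.
have [x0|x0] := leP x 0.
  rewrite (_ : _ @^-1` _ = set0)//; apply/seteqP; split => // w /=.
  by rewrite in_itv/= ltNge (le_trans x0 (inverse_process_ge0 w)).
(* On [never] the value of [Y] is 0, which lies below the positive [x]. *)
have -> : Y @^-1` `]-oo, x[%classic = never `|` \bigcup_(q : rat)
    (if (0 <= ratr q :> R) && (ratr q < x) then passed (ratr q) else set0).
  apply/seteqP; split => w.
    rewrite /=in_itv/= => Yx.
    have [Y0|/set0P Y0] := eqVneq (Yset w) set0.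
      by left; apply/neverP.
    right; have [u Yu ux] := inf_lt Y0 Yx.
    have [q [q0 qx pq]] := Yset_rat Yu ux.
    by exists q => //; rewrite q0 qx.
  move=> [/neverP Y0|[q _]] /=; rewrite in_itv/=.
    by rewrite /Y /inverse_process -/(Yset w) Y0 inf0.
  case: ifPn => // /andP[q0 qx] pq.
  exact: le_lt_trans (Y_le q0 pq) qx.
apply: measurableU => //; apply: bigcupT_measurable_rat => q.
by case: ifPn => // /andP[q0 _]; exact: mpassed.
Qed.

Let P_never : P never = 0%E.
Proof.
have fP A : measurable A -> P A \is a fin_num by move=> mA; exact: fin_num_measure.
(* Every event [passed x] lies outside [never], so the probability of the complement bounds all
   truncated masses of the density. *)
have : 1 <= fine (P (~` never)).
  apply: (@inverse_density_mass_ge1 R n b l t b0 l0 t0) => x x0.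
  rewrite -P_passed// fineK ?fP//; last exact: measurableC.
  apply: le_measure; rewrite ?inE; [exact: mpassed|exact: measurableC|].
  move=> w pw; move=> /neverP Y0.
  suff : Yset w x by rewrite Y0.
  by split.
rewrite -lee_fin fineK ?fP//; last exact: measurableC.
rewrite probability_setC// => h; apply/eqP; rewrite eq_le measure_ge0 andbT.
move: h; rewrite -(fineK (fP _ mnever)) -EFinB !lee_fin.
by rewrite lerBrDr gerDl.
Qed.

Let nonpositive_jump : set T := \bigcup_j G j @^-1` (~` `]0%R, +oo[%classic).

Let mnonpositive j : measurable (G j @^-1` (~` `]0%R, +oo[%classic)).
Proof.
by rewrite -[X in measurable X]setTI; apply: mG => //; apply: measurableC.
Qed.

Let mnonpositive_jump : measurable nonpositive_jump.
Proof. exact: bigcupT_measurable. Qed.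

Let P_nonpositive_jump : P nonpositive_jump = 0%E.
Proof.
apply/eqP; rewrite eq_le measure_ge0 andbT.
apply: (le_trans (measure_sigma_subadditive _ mnonpositive mnonpositive_jump _)) => //.
by rewrite eseries0// => j _ _; exact: (gamma_pos gammaG).
Qed.

(** If the level is not passed at [x], it is not passed on some [[x, x + e)] by local constancy, nor
    before [x], as positive jumps make the path nondecreasing. The infimum of the passing times is
    then at least [x + e]. *)
Let passed_Y_le x w : 0 <= x -> ~ never w -> ~ nonpositive_jump w ->
  Y w <= x -> passed x w.
Proof.
move=> x0 nnever npos Yx; apply: contrapT => /negP; rewrite -leNgt => Xt.
have [e e0 Xe] := X_locally_constant w x0.
have Y0 : Yset w !=set0.
  by apply/set0P/eqP => /neverP.
suff : x + e <= Y w by move=> /le_trans/(_ Yx); rewrite gerDl leNgt e0.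
apply: lb_le_inf => // u [u0 tX]; rewrite leNgt; apply/negP => ux.
have [xu|xu] := leP x u.
  by move: tX; rewrite Xe// ltNge Xt.
move: tX; rewrite ltNge => /negP; apply; apply: le_trans Xt.
rewrite !XE//.
have Nux : (N u w <= N x w)%N by apply: (poisson_process_mono poissonN) => //; exact: ltW.
rewrite -(subnKC Nux) big_split_ord/= lerDl sumr_ge0// => i _.
rewrite leNgt; apply/negP => Gi; apply: npos; exists (N u w + i)%N => //=.
by rewrite in_itv/= andbT => /ltW; rewrite leNgt Gi.
Qed.

Lemma inverse_process_cdf x : 0 <= x ->
  P [set w | Y w <= x] = (\int[mu]_(u in `[0%R, x]) inverse_density n b l t u)%E.
Proof.
move=> x0; rewrite -P_passed//.
have mYx : measurable [set w | Y w <= x].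
  rewrite -[X in measurable X]setTI; apply: measurable_fun_ler => //.
  exact: measurable_inverse_process.
have mp := mpassed x0.
apply/eqP; rewrite eq_le; apply/andP; split; last first.
  by apply: le_measure; rewrite ?inE// => w; exact: Y_le.
apply: (@le_trans _ _ (P (passed x `|` (never `|` nonpositive_jump)))).
  apply: le_measure; rewrite ?inE//; first by do 2?apply: measurableU.
  move=> w Yx; have [nw|nw] := pselect (never w); first by right; left.
  have [jw|jw] := pselect (nonpositive_jump w); first by right; right.
  by left; exact: passed_Y_le.
apply: (le_trans (measureU2 _ _ _)) => //; first exact: measurableU.
rewrite -[leRHS]adde0 leeD2l//.
apply: (le_trans (measureU2 _ _ _)) => //.
have never0 : (P never <= 0)%E by rewrite P_never.
have jump0 : (P nonpositive_jump <= 0)%E by rewrite P_nonpositive_jump.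
by rewrite -[leRHS]adde0; exact: leeD.
Qed.

End inverse_law.

(** * Time-changed Poisson processes *)

Section ceil_index.
Context {R : realType}.

(* Rounding up approximates the random time from the side on which the paths are
   continuous. *)
Definition ceil_index (l : nat) (x : R) : nat :=
  `|Num.max (0 : int) (Num.ceil (x * l.+1%:R))|%N.

Lemma ceil_index_le l x j : (ceil_index l x <= j)%N = (x * l.+1%:R <= j%:R).
Proof.
rewrite /ceil_index -lez_nat gez0_abs; last by rewrite le_max lexx.
by rewrite ge_max/= ceil_le_int.
Qed.

Lemma measurable_ceil_index l : measurable_fun setT (ceil_index l).
Proof.
apply: measurable_fun_to_nat => j.
rewrite (_ : [set _ | _] = `]-oo, j%:R / l.+1%:R]%classic).
  exact: measurable_itv.
by apply/seteqP; split => x /=; rewrite ceil_index_le in_itv/= ler_pdivlMr.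
Qed.

Lemma ceil_index_itv l (x : R) : 0 <= x ->
  x <= (ceil_index l x)%:R / l.+1%:R < x + l.+1%:R^-1.
Proof.
move=> x0; rewrite ler_pdivlMr// -ceil_index_le leqnn/=.
rewrite -[X in _ < _ + X]mul1r ltr_pdivrMr// mulrDl -mulrA mulVf ?mulr1//.
case E : (ceil_index l x) => [|j]; first by rewrite ltr_wpDl// mulr_ge0.
rewrite -natr1 ltrD2r ltNge -ceil_index_le E.
by rewrite -ltnNge.
Qed.

End ceil_index.

(** * A pair of Poisson processes at an independent random time *)

Section time_change.
Context d (T : measurableType d) (R : realType) (P : probability T R).
Notation mu := (@lebesgue_measure R).
Variables (l1 l2 : R) (N1 N2 : R -> T -> nat) (Z : R -> T -> R) (t : R).
Variable f : R -> \bar R.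
Hypotheses (l10 : 0 < l1) (l20 : 0 < l2) (t0 : 0 <= t).
Hypothesis poissonN1 : poisson_process P l1 N1.
Hypothesis poissonN2 : poisson_process P l2 N2.
Hypothesis indep : mutually_independent P
  (tnth [tuple salgebra_of_process N1; salgebra_of_process N2;
               salgebra_of_process Z]).
Hypothesis mZ : measurable_fun setT (Z t).
Hypothesis Z0 : forall w, 0 <= Z t w.
Let D : set R := `[0%R, +oo[%classic.
Hypothesis mf : measurable_fun D f.
Hypothesis f0 : forall x, 0 <= x -> (0 <= f x)%E.
Hypothesis ffin : forall x, 0 <= x -> f x \is a fin_num.
Hypothesis fy : (\int[mu]_(x in D) f x < +oo)%E.
Hypothesis cdf : forall x, 0 <= x ->
  P [set w | Z t w <= x] = (\int[mu]_(u in `[0%R, x]) f u)%E.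

Let mD : measurable D. Proof. exact: measurable_itv. Qed.

Let D0 x : D x -> 0 <= x. Proof. by rewrite /D/= in_itv/= andbT. Qed.

Let mZ' B : measurable B -> measurable (Z t @^-1` B).
Proof. by move=> mB; rewrite -[X in measurable X]setTI; exact: mZ. Qed.

Let mcell l j : measurable (D `&` ceil_index l @^-1` [set j]).
Proof.
apply: measurableI => //; rewrite -[X in measurable X]setTI.
exact: measurable_ceil_index.
Qed.

Let initial_segment l j : D `&` [set x | (ceil_index l x <= j)%N] =
  `[0%R, j%:R / l.+1%:R]%classic.
Proof.
apply/seteqP; split => x; rewrite /D/= ceil_index_le !in_itv/= ?andbT.
  by move=> [-> ?]; rewrite ler_pdivlMr.
by move=> /andP[->]; rewrite ler_pdivlMr.
Qed.

Let law_initial_segment l j :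
  P (Z t @^-1` (D `&` [set x | (ceil_index l x <= j)%N])) =
  (\int[mu]_(x in D `&` [set x | (ceil_index l x <= j)%N]) f x)%E.
Proof.
rewrite initial_segment -cdf; last by rewrite divr_ge0.
congr (P _); apply/seteqP; split => w /=; rewrite in_itv/= ?Z0//.
Qed.

(** Only the distribution function of [Z t] is given. A cell is the difference of two initial
    segments, and finiteness of the probabilities permits the subtraction. *)
Let law_cell l j : P (Z t @^-1` (D `&` ceil_index l @^-1` [set j])) =
  (\int[mu]_(x in D `&` ceil_index l @^-1` [set j]) f x)%E.
Proof.
case: j => [|j].
  have <- : D `&` [set x | (ceil_index l x <= 0)%N] =
      D `&` ceil_index l @^-1` [set 0%N].
    apply/seteqP; split => x [Dx] /=; rewrite leqn0.
      by move=> /eqP.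
    by move=> ->.
  exact: law_initial_segment.
have := law_initial_segment l j.+1.
have mseg : measurable (D `&` [set x | (ceil_index l x <= j)%N]).
  by rewrite initial_segment; exact: measurable_itv.
have -> : D `&` [set x | (ceil_index l x <= j.+1)%N] =
  (D `&` [set x | (ceil_index l x <= j)%N]) `|`
  (D `&` ceil_index l @^-1` [set j.+1]).
  apply/seteqP; split => x.
    move=> [Dx] /=; rewrite leq_eqVlt => /predU1P[xj|]; first by right.
    by rewrite ltnS => xj; left.
  by move=> [[Dx/= xj]|[Dx/= ->]]; split => //=; exact: leqW.
have disj : [disjoint D `&` [set x | (ceil_index l x <= j)%N] &
    D `&` ceil_index l @^-1` [set j.+1]].
  by apply/disj_setPS => x [[_ /= xj] [_ /= xj1]]; move: xj; rewrite xj1 ltnn.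
rewrite ge0_integral_setU//; last 3 first.
- exact: mcell.
- by apply: measurable_funS mf => // x [[]|[]].
- by move=> x [[Dx _]|[Dx _]]; apply: f0; exact: D0.
set A := D `&` [set x | _]; set B := D `&` _.
have -> : P (Z t @^-1` (A `|` B)) = (P (Z t @^-1` A) + P (Z t @^-1` B))%E.
  rewrite preimage_setU measureU//; [exact: mZ'|apply: mZ'; exact: mcell|].
  rewrite -preimage_setI; move/disj_set2P : disj => ->.
  by rewrite preimage_set0.
have PA : P (Z t @^-1` A) \is a fin_num by apply: fin_num_measure; exact: mZ'.
rewrite -law_initial_segment -/A => PAB.
by rewrite -[LHS](addeK _ PA) -[RHS](addeK _ PA); congr (_ - _)%E;
  rewrite addeC PAB addeC.
Qed.

Let mN1 x a : 0 <= x -> measurable [set w | N1 x w = a].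
Proof. exact: (poisson_process_measurable_preimage poissonN1 [set a]). Qed.

Let mN2 x a : 0 <= x -> measurable [set w | N2 x w = a].
Proof. exact: (poisson_process_measurable_preimage poissonN2 [set a]). Qed.

Let indep_cell x a1 a2 (B : set R) : 0 <= x -> measurable B ->
  (P (Z t @^-1` B `&` ([set w | N1 x w = a1] `&` [set w | N2 x w = a2])) =
   P (Z t @^-1` B) * ((poi (l1 * x) a1)%:E * (poi (l2 * x) a2)%:E))%E.
Proof.
move=> x0 mB; rewrite setIC.
transitivity (P [set w | N1 x w = a1] * P [set w | N2 x w = a2] *
    P (Z t @^-1` B))%E.
  apply: (mutually_independent3 indep).
  - exact: (@salgebra_of_familyP _ _ _ _ _ [set t | 0 <= t] N1 x [set a1]).
  - exact: (@salgebra_of_familyP _ _ _ _ _ [set t | 0 <= t] N2 x [set a2]).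
  - exact: (@salgebra_of_familyP _ _ _ _ _ [set t | 0 <= t] Z t).
  - exact: mN1.
  - exact: mN2.
  - exact: mZ'.
rewrite (poisson_process_marginal l10 poissonN1)//.
by rewrite (poisson_process_marginal l20 poissonN2)// muleC.
Qed.

Let P_pair x a1 a2 : 0 <= x ->
  (P ([set w | N1 x w = a1] `&` [set w | N2 x w = a2]) =
   (poi (l1 * x) a1)%:E * (poi (l2 * x) a2)%:E)%E.
Proof.
move=> x0; have := @indep_cell x a1 a2 setT x0 measurableT.
by rewrite preimage_setT setTI probability_setT mul1e.
Qed.

Lemma time_changed_pair a1 a2 :
  measurable [set w | N1 (Z t w) w = a1 /\ N2 (Z t w) w = a2] /\
  (P [set w | N1 (Z t w) w = a1 /\ N2 (Z t w) w = a2] =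
   \int[mu]_(u in D) ((poi (l1 * u) a1 * poi (l2 * u) a2)%:E * f u))%E.
Proof.
(* Negative times carry no information on [N1] and [N2], not even measurability; the empty set keeps
   [E] measurable there, and [Z t] never takes such values. *)
pose E x := if 0 <= x then [set w | N1 x w = a1] `&` [set w | N2 x w = a2]
  else set0.
have [|||||||||||] := @probability_freezing _ T R P (Z t) D f E ceil_index
    (fun l j => j%:R / l.+1%:R).
- exact: mZ.
- exact: mD.
- exact: mf.
- by move=> x /D0; exact: f0.
- by move=> x /D0; exact: ffin.
- exact: fy.
- exact: measurable_ceil_index.
- exact: law_cell.
- move=> x; rewrite /E; case: ifPn => // x0.
  by apply: measurableI; [exact: mN1|exact: mN2].
- move=> l j; have jl0 : 0 <= j%:R / l.+1%:R :> R by rewrite divr_ge0.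
  by rewrite /E jl0 indep_cell// P_pair.
- move=> x /D0 x0 w.
  have [e1 e10 Ne1] := poisson_process_locally_constant poissonN1 w x0.
  have [e2 e20 Ne2] := poisson_process_locally_constant poissonN2 w x0.
  have e0 : 0 < Num.min e1 e2 by rewrite lt_min e10.
  (* The mesh is taken smaller than both lengths of constancy to the right of [x]; rounding up then
     changes neither count. *)
  near=> l.
  have le : l.+1%:R^-1 < Num.min e1 e2.
    by near: l; exact: near_infty_natSinv_lt (PosNum e0).
  have /andP[xc cx] := ceil_index_itv l x0.
  have cx' : (ceil_index l x)%:R / l.+1%:R < x + Num.min e1 e2.
    by rewrite (lt_trans cx)// ltrD2l.
  rewrite /E x0 (le_trans x0 xc)/=.
  have -> : N1 ((ceil_index l x)%:R / l.+1%:R) w = N1 x w.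
    apply: Ne1 => //; rewrite (lt_le_trans cx')// lerD2l.
    by rewrite ge_min lexx.
  have -> : N2 ((ceil_index l x)%:R / l.+1%:R) w = N2 x w.
    apply: Ne2 => //; rewrite (lt_le_trans cx')// lerD2l.
    by rewrite ge_min lexx orbT.
  by [].
have -> : [set w | D (Z t w) /\ E (Z t w) w] =
    [set w | N1 (Z t w) w = a1 /\ N2 (Z t w) w = a2].
  apply/seteqP; split => w; rewrite /= /E Z0; first by case.
  by move=> ?; split => //; rewrite /D/= in_itv/= Z0.
move=> mE _ ->; split => //; apply: eq_integral => u; rewrite inE => /D0 u0.
by rewrite /E u0 P_pair.
Unshelve. all: end_near. Qed.

Lemma nneseries_pick (h : nat -> \bar R) m :
  (\sum_(k <oo) (if k == m then h k else 0) = h m)%E.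
Proof.
apply: lim_near_cst => //; near=> M.
rewrite -big_mkcond/= big_mkord.
have mM : (m < M)%N by near: M; exact: nbhs_infty_gt.
by rewrite (big_pred1 (Ordinal mM)).
Unshelve. all: end_near. Qed.

(** Covers both claims of the theorem: [g] will be the indicator of [a1 - a2 = k] for the
    probabilities and an exponential of [a1 - a2] for the moment generating function. *)
Lemma integral_time_changed_pair (g : nat -> nat -> R) :
  (forall a1 a2, 0 <= g a1 a2) ->
  (\int[P]_w (g (N1 (Z t w) w) (N2 (Z t w) w))%:E =
   \int[mu]_(u in D) ((\sum_(a1 <oo) \sum_(a2 <oo)
     (g a1 a2 * (poi (l1 * u) a1 * poi (l2 * u) a2))%:E) * f u))%E.
Proof.
move=> g0.
pose A a1 a2 := [set w | N1 (Z t w) w = a1 /\ N2 (Z t w) w = a2].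
have mA a1 a2 : measurable (A a1 a2) by have [] := time_changed_pair a1 a2.
have pp0 a1 a2 u : 0 <= u -> 0 <= poi (l1 * u) a1 * poi (l2 * u) a2.
  by move=> u0; apply: mulr_ge0; apply: poi_ge0; apply: mulr_ge0 => //; exact: ltW.
pose F a1 a2 w : \bar R := (g a1 a2 * \1_(A a1 a2) w)%:E.
have F0 a1 a2 w : (0 <= F a1 a2 w)%E by rewrite lee_fin mulr_ge0.
have mF a1 a2 : measurable_fun setT (F a1 a2).
  apply/measurable_EFinP; apply: measurable_funM => //.
have mFF a1 : measurable_fun setT (fun w => \sum_(a2 <oo) F a1 a2 w)%E.
  have := @ge0_emeasurable_sum _ T R setT (F a1) xpredT.
  by apply => [k x _ _|k _].
(* The events [A a1 a2] partition the sample space, so only the pair of actual counts contributes to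
   the double series. *)
transitivity (\int[P]_w (\sum_(a1 <oo) \sum_(a2 <oo) F a1 a2 w))%E.
  apply: eq_integral => w _.
  pose h a1 := (\sum_(a2 <oo) F a1 a2 w)%E.
  transitivity (\sum_(a1 <oo) (if a1 == N1 (Z t w) w then h a1 else 0))%E; last first.
    apply: eq_eseriesr => a1 _; case: eqP => // a1N.
    rewrite eseries0// => a2 _ _; rewrite /F indicE memNset ?mulr0//.
    by move=> [] /esym.
  rewrite nneseries_pick /h.
  transitivity (\sum_(a2 <oo) (if a2 == N2 (Z t w) w then F (N1 (Z t w) w) a2 w else 0))%E; last first.
    apply: eq_eseriesr => a2 _; case: eqP => // a2N.
    rewrite /F indicE memNset ?mulr0//.
    by move=> [_] /esym.
  by rewrite nneseries_pick /F indicE mem_set ?mulr1.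
rewrite integral_nneseries//; last by move=> a1 w _; exact: nneseries_ge0.
pose H a1 a2 u : \bar R :=
  ((g a1 a2 * (poi (l1 * u) a1 * poi (l2 * u) a2))%:E * f u)%E.
have H0 a1 a2 u : D u -> (0 <= H a1 a2 u)%E.
  move=> /D0 u0; rewrite mule_ge0 ?f0// lee_fin.
  by apply: mulr_ge0 => //; exact: pp0.
have mpoi (l : R) a : measurable_fun D (fun u => poi (l * u) a).
  apply: measurable_funTS; apply: (measurableT_comp (f := poi^~ a)).
    by apply: continuous_measurable_fun; exact: continuous_poi.
  exact: measurable_funM.
have mpp a1 a2 : measurable_fun D (fun u =>
    (poi (l1 * u) a1 * poi (l2 * u) a2)%:E).
  by apply/measurable_EFinP; apply: measurable_funM; exact: mpoi.
have mH a1 a2 : measurable_fun D (H a1 a2).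
  apply: emeasurable_funM => //.
  apply/measurable_EFinP; apply: measurable_funM => //.
  by apply/measurable_EFinP; exact: mpp.
have IF a1 a2 : (\int[P]_w F a1 a2 w = \int[mu]_(u in D) H a1 a2 u)%E.
  transitivity ((g a1 a2)%:E * P (A a1 a2))%E.
    rewrite /F; under eq_integral do rewrite EFinM.
    rewrite ge0_integralZl_EFin//; last first.
      by apply/measurable_EFinP.
    by rewrite integral_indic// setIT.
  have [_ ->] := time_changed_pair a1 a2.
  rewrite -ge0_integralZl_EFin//.
  - by apply: eq_integral => u _; rewrite muleA -EFinM.
  - by move=> u /D0 u0; rewrite mule_ge0 ?f0// lee_fin pp0.
  - by apply: (@emeasurable_funM _ _ R D) => //; exact: mpp.
transitivity (\sum_(a1 <oo) \sum_(a2 <oo) \int[mu]_(u in D) H a1 a2 u)%E.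
  apply: eq_eseriesr => a1 _; rewrite integral_nneseries//.
  by apply: eq_eseriesr => a2 _; exact: IF.
transitivity (\sum_(a1 <oo) \int[mu]_(u in D) \sum_(a2 <oo) H a1 a2 u)%E.
  apply: eq_eseriesr => a1 _; rewrite integral_nneseries//; first exact: mH.
  by move=> a2 u; exact: H0.
rewrite -integral_nneseries//; last 2 first.
- by move=> a1; apply: measurable_nneseries => // a2 u; exact: H0.
- by move=> a1 u Du; apply: nneseries_ge0 => a2 _ _; exact: H0.
apply: eq_integral => u; rewrite inE => Du; have u0 := D0 Du.
have c0 a1 a2 : (0 <= (g a1 a2 * (poi (l1 * u) a1 * poi (l2 * u) a2))%:E)%E.
  by rewrite lee_fin mulr_ge0// pp0.
rewrite /H -(fineK (ffin u0)); move: (fine (f u)) => r.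
rewrite muleC -nneseriesZl; last by move=> a1 _; exact: nneseries_ge0.
apply: eq_eseriesr => a1 _.
rewrite -nneseriesZl//.
by apply: eq_eseriesr => a2 _; rewrite muleC.
Qed.

End time_change.

(** * Bessel, Wright and Mittag-Leffler series *)

Section special_function_series.
Context {R : realType}.
Notation mu := (@lebesgue_measure R).

(** Passes from [limn] of real partial sums, by which the special functions are defined and which is
    informative only under convergence, to extended real series, where nonnegative sums can be
    interchanged freely. *)
Lemma EFin_limn_series (c : nat -> R) : (forall j, 0 <= c j) ->
  (\sum_(j <oo) (c j)%:E < +oo)%E ->
  (limn (series c))%:E = (\sum_(j <oo) (c j)%:E)%E.
Proof.
move=> c0 cy.
have cfin : (\sum_(j <oo) (c j)%:E)%E \is a fin_num.
  by rewrite ge0_fin_numE// nneseries_ge0// => j _ _; rewrite lee_fin.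
have cvc : (fun k => (series c k)%:E) @ \oo --> (\sum_(j <oo) (c j)%:E)%E.
  have /cvg_ex[L cL] : cvgn (fun k => \sum_(0 <= j < k) (c j)%:E)%E.
    by apply: is_cvg_nneseries => j _ _; rewrite lee_fin.
  rewrite (cvg_lim _ cL)//; apply: cvg_trans cL.
  by apply: near_eq_cvg; apply: nearW => k; rewrite /series/= sumEFin.
by rewrite -(fineK cfin) in cvc *; have /fine_cvg/(cvg_lim _) -> := cvc.
Qed.

Lemma fact_ge1 (k : nat) : 1 <= k`!%:R :> R.
Proof. by rewrite ler1n fact_gt0. Qed.

Lemma nneseries_le_exp_lty (c : nat -> R) (a x : R) : 0 <= a -> 0 <= x ->
  (forall j, 0 <= c j <= a * exp_coeff x j) -> (\sum_(j <oo) (c j)%:E < +oo)%E.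
Proof.
move=> a0 x0 cx; apply: (@le_lt_trans _ _ (\sum_(j <oo) a%:E * (exp_coeff x j)%:E)%E).
  apply: lee_nneseries => [j _ _|j _]; have /andP[cj0 cj] := cx j.
    by rewrite lee_fin.
  by rewrite -EFinM lee_fin.
rewrite nneseriesZl; last by move=> j _; rewrite lee_fin exp_coeff_ge0.
by rewrite nneseries_exp_coeff// ltry.
Qed.

Lemma besselIE k (z : R) : 0 <= z -> (besselI k z)%:E =
  (\sum_(j <oo) ((z / 2) ^+ (2 * j + k) / (j`! * (j + k)`!)%:R)%:E)%E.
Proof.
move=> z0; have z20 : 0 <= z / 2 by rewrite divr_ge0.
apply: EFin_limn_series => [j|]; first by rewrite divr_ge0// exprn_ge0.
apply: (@nneseries_le_exp_lty _ ((z / 2) ^+ k) ((z / 2) ^+ 2)).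
- by rewrite exprn_ge0.
- by rewrite exprn_ge0.
move=> j; rewrite divr_ge0 ?exprn_ge0//=.
rewrite exprD exprM mulrC /exp_coeff/= natrM invfM mulrCA -!mulrA.
rewrite [leRHS]mulrCA ler_wpM2l ?exprn_ge0//.
rewrite mulrA mulrC ler_wpM2l ?exprn_ge0//.
by rewrite ler_piMr ?invr_ge0// invf_le1 ?fact_ge1// ltr0n fact_gt0.
Qed.

Lemma Gamma_affine n m i :
  Gamma (n.+1%:R * m%:R + i.+1%:R : R) = (m * n.+1 + i)`!%:R.
Proof. by rewrite -natrM -natrD addnS Gamma_nat mulnC. Qed.

Lemma wrightE n i (z : R) : 0 <= z -> (wright n.+1%:R i.+1%:R z)%:E =
  (\sum_(j <oo) (exp_coeff z j / (j * n.+1 + i)`!%:R)%:E)%E.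
Proof.
move=> z0; rewrite /wright; under [X in series X]eq_fun do rewrite Gamma_affine invfM mulrA.
apply: EFin_limn_series => [j|]; first by rewrite divr_ge0// exp_coeff_ge0.
apply: (@nneseries_le_exp_lty _ 1 z) => // j.
rewrite divr_ge0 ?exp_coeff_ge0//= mul1r ler_piMr ?exp_coeff_ge0//.
by rewrite invf_le1 ?fact_ge1// ltr0n fact_gt0.
Qed.

Lemma mittag_lefflerE n i (z : R) : 0 <= z ->
  (mittag_leffler n.+1%:R i.+1%:R z)%:E =
  (\sum_(j <oo) (z ^+ j / (j * n.+1 + i)`!%:R)%:E)%E.
Proof.
move=> z0; rewrite /mittag_leffler; under [X in series X]eq_fun do rewrite Gamma_affine.
apply: EFin_limn_series => [j|]; first by rewrite divr_ge0// exprn_ge0.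
apply: (@nneseries_le_exp_lty _ 1 z) => // j.
rewrite divr_ge0 ?exprn_ge0//= mul1r /exp_coeff/= ler_wpM2l ?exprn_ge0//.
rewrite lef_pV2 ?posrE ?ltr0n ?fact_gt0// ler_nat leq_fact//.
by rewrite mulnS -addnA leq_addr.
Qed.

Lemma besselI_ge0 k (z : R) : 0 <= z -> 0 <= besselI k z.
Proof.
move=> z0; rewrite -lee_fin besselIE//; apply: nneseries_ge0 => j _ _.
by rewrite lee_fin divr_ge0// exprn_ge0// divr_ge0.
Qed.

Lemma wright_ge0 n i (z : R) : 0 <= z -> 0 <= wright n.+1%:R i.+1%:R z.
Proof.
move=> z0; rewrite -lee_fin wrightE//; apply: nneseries_ge0 => j _ _.
by rewrite lee_fin divr_ge0// exp_coeff_ge0.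
Qed.

Let D : set R := `[0%R, +oo[%classic.

Lemma measurable_besselI k (a : R) : 0 <= a ->
  measurable_fun D (fun u => (besselI k (u * a))%:E).
Proof.
move=> a0; have D0 u : u \in D -> 0 <= u by rewrite inE /D/= in_itv/= andbT.
apply: (@eq_measurable_fun _ _ _ _ D (fun u => \sum_(j <oo)
    ((u * a / 2) ^+ (2 * j + k) / (j`! * (j + k)`!)%:R)%:E)%E).
  by move=> u /D0 u0; rewrite besselIE// mulr_ge0.
apply: measurable_nneseries => [j u Du|j].
  rewrite lee_fin divr_ge0// exprn_ge0// divr_ge0// mulr_ge0//.
  by apply: D0; rewrite inE.
apply/measurable_EFinP; apply: measurable_funM => //; apply: measurable_funX.
by apply: measurable_funM => //; exact: measurable_funM.
Qed.

Lemma measurable_wright n i (a : R) : 0 <= a ->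
  measurable_fun D (fun u => (wright n.+1%:R i.+1%:R (u * a))%:E).
Proof.
move=> a0; have D0 u : u \in D -> 0 <= u by rewrite inE /D/= in_itv/= andbT.
apply: (@eq_measurable_fun _ _ _ _ D (fun u => \sum_(j <oo)
    (exp_coeff (u * a) j / (j * n.+1 + i)`!%:R)%:E)%E).
  by move=> u /D0 u0; rewrite wrightE// mulr_ge0.
apply: measurable_nneseries => [j u Du|j].
  rewrite lee_fin divr_ge0// exp_coeff_ge0// mulr_ge0//.
  by apply: D0; rewrite inE.
apply/measurable_EFinP; apply: measurable_funM => //; apply: measurable_funM => //.
by apply: measurable_funX; exact: measurable_funM.
Qed.

End special_function_series.

(** * Skellam weights: Bessel functions and exponential moments *)

Section skellam.
Context {R : realType}.
Variables (l1 l2 : R).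
Hypotheses (l10 : 0 < l1) (l20 : 0 < l2).

(** The product [k1 * k2] is the square of its root, which absorbs the [j] paired factors; each of
    the [K] unpaired factors [k1] splits as [sqrt (k1 / k2) * sqrt (k1 * k2)]. The intensities are
    arbitrary, since negative differences require them exchanged. *)
Lemma bessel_term (k1 k2 u : R) K j : 0 < k1 -> 0 < k2 -> 0 <= u ->
  poi (k1 * u) (j + K) * poi (k2 * u) j =
  expR (- (u * (k1 + k2))) * Num.sqrt (k1 / k2) ^+ K *
  ((2 * u * Num.sqrt (k1 * k2) / 2) ^+ (2 * j + K) / (j`! * (j + K)`!)%:R).
Proof.
move=> k10 k20 u0.
have k1E : k1 = Num.sqrt k1 ^+ 2 by rewrite sqr_sqrtr// ltW.
have k2E : k2 = Num.sqrt k2 ^+ 2 by rewrite sqr_sqrtr// ltW.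
have s20 : Num.sqrt k2 != 0 by rewrite sqrtr_eq0 -ltNge.
rewrite sqrtrM ?(ltW k10)// sqrtrM ?(ltW k10)// sqrtrV ?(ltW k20)//.
rewrite /poi /exp_coeff/= natrM invfM.
have -> : expR (- (u * (k1 + k2))) = expR (- (k1 * u)) * expR (- (k2 * u)).
  by rewrite -expRD; congr expR; ring.
have -> : 2 * u * (Num.sqrt k1 * Num.sqrt k2) / 2 = u * (Num.sqrt k1 * Num.sqrt k2).
  by field.
have -> : (k1 * u) ^+ (j + K) = (k1 * u) ^+ j * (k1 * u) ^+ K by rewrite exprD.
have -> : (u * (Num.sqrt k1 * Num.sqrt k2)) ^+ (2 * j + K) =
    (k1 * u) ^+ j * (k2 * u) ^+ j * (u * (Num.sqrt k1 * Num.sqrt k2)) ^+ K.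
  rewrite exprD exprM -exprMn; congr (_ ^+ _ * _).
  by rewrite {2}k1E {2}k2E; ring.
have -> : (k1 * u) ^+ K = (Num.sqrt k1 / Num.sqrt k2) ^+ K *
    (u * (Num.sqrt k1 * Num.sqrt k2)) ^+ K.
  rewrite -exprMn; congr (_ ^+ _); rewrite {1}k1E; field.
  exact: s20.
ring.
Qed.

Lemma skellam_diagonal (k1 k2 u : R) K : 0 < k1 -> 0 < k2 -> 0 <= u ->
  (\sum_(j <oo) (poi (k1 * u) (j + K) * poi (k2 * u) j)%:E =
   (expR (- (u * (k1 + k2))) * Num.sqrt (k1 / k2) ^+ K *
    besselI K (2 * u * Num.sqrt (k1 * k2)))%:E)%E.
Proof.
move=> k10 k20 u0; have z0 : 0 <= 2 * u * Num.sqrt (k1 * k2).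
  by rewrite mulr_ge0 ?sqrtr_ge0// mulr_ge0.
rewrite [RHS]EFinM besselIE// -nneseriesZl; last first.
  by move=> j _; rewrite lee_fin divr_ge0// exprn_ge0// divr_ge0.
by apply: eq_eseriesr => j _; rewrite bessel_term.
Qed.

Lemma powR_half_natmul (x : R) K : 0 <= x -> x `^ (K%:R / 2) = Num.sqrt x ^+ K.
Proof.
by move=> x0; rewrite mulrC powRrM powR12_sqrt// powR_mulrn// sqrtr_ge0.
Qed.

Lemma skellam_pmf (k : int) u : 0 <= u ->
  (\sum_(a1 <oo) \sum_(a2 <oo) (((a1%:Z - a2%:Z == k)%:R : R) *
     (poi (l1 * u) a1 * poi (l2 * u) a2))%:E =
   ((l1 / l2) `^ (k%:~R / 2) * (expR (- (u * (l1 + l2))) *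
     besselI `|k|%N (2 * u * Num.sqrt (l1 * l2))))%:E)%E.
Proof.
move=> u0.
have pp0 a1 a2 : 0 <= poi (l1 * u) a1 * poi (l2 * u) a2.
  by apply: mulr_ge0; apply: poi_ge0; apply: mulr_ge0 => //; exact: ltW.
case: k => K.
  (* On the diagonal [a1 = a2 + K] the free index is [a2], so the sum over [a1] is made the inner
     one. *)
  rewrite nneseries_interchange; last by move=> a1 a2; rewrite lee_fin mulr_ge0.
  transitivity (\sum_(a2 <oo) (poi (l1 * u) (a2 + K) * poi (l2 * u) a2)%:E)%E.
    apply: eq_eseriesr => a2 _.
    rewrite -(nneseries_pick (fun a1 => (poi (l1 * u) a1 * poi (l2 * u) a2)%:E)).
    apply: eq_eseriesr => a1 _.
    rewrite subr_eq -PoszD eqz_nat addnC.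
    by case: eqP => _; rewrite ?mul1r ?mul0r.
  rewrite skellam_diagonal// powR_half_natmul; last by rewrite divr_ge0// ltW.
  by congr EFin; rewrite mulrCA mulrA.
(* [Negz K] is [- (K + 1)], so that [a2 = a1 + K.+1]: the free index is [a1] and the intensities
   exchange roles. The negative exponent of the power compensates the inverted ratio. *)
transitivity (\sum_(a1 <oo) (poi (l2 * u) (a1 + K.+1) * poi (l1 * u) a1)%:E)%E.
  apply: eq_eseriesr => a1 _.
  rewrite (mulrC (poi (l2 * u) _)) -(nneseries_pick (fun a2 => (poi (l1 * u) a1 * poi (l2 * u) a2)%:E)).
  apply: eq_eseriesr => a2 _.
  rewrite NegzE subr_eq addrC eq_sym subr_eq -PoszD eqz_nat.
  by case: eqP => _; rewrite ?mul1r ?mul0r.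
rewrite skellam_diagonal// NegzE abszN mulrNz mulNr powRN.
rewrite powR_half_natmul; last by rewrite divr_ge0// ltW.
rewrite -exprVn -sqrtrV; last by rewrite divr_ge0// ltW.
by rewrite invf_div (mulrC l2 l1) (addrC l2); congr EFin; rewrite mulrCA mulrA.
Qed.

Lemma nneseries_poi_exp (x y : R) : 0 <= x ->
  (\sum_(k <oo) (expR (y * k%:R) * poi x k)%:E = (expR (x * (expR y - 1)))%:E)%E.
Proof.
move=> x0.
transitivity (\sum_(k <oo) (expR (- x))%:E * (exp_coeff (x * expR y) k)%:E)%E.
  apply: eq_eseriesr => k _; rewrite -EFinM; congr EFin.
  by rewrite /poi /exp_coeff/= exprMn -expRM_natr; ring.
have xy0 : 0 <= x * expR y by rewrite mulr_ge0// expR_ge0.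
rewrite nneseriesZl; last by move=> k _; rewrite lee_fin exp_coeff_ge0.
rewrite nneseries_exp_coeff// -EFinM -expRD; congr (expR _)%:E.
by ring.
Qed.

Lemma skellam_mgf (theta u : R) : 0 <= u ->
  (\sum_(a1 <oo) \sum_(a2 <oo) (expR (theta * (a1%:Z - a2%:Z)%:~R) *
     (poi (l1 * u) a1 * poi (l2 * u) a2))%:E =
   (expR (- (u * skellam_exponent l1 l2 (- theta))))%:E)%E.
Proof.
move=> u0.
have lu1 : 0 <= l1 * u by rewrite mulr_ge0// ltW.
have lu2 : 0 <= l2 * u by rewrite mulr_ge0// ltW.
transitivity (\sum_(a1 <oo) ((expR (l2 * u * (expR (- theta) - 1)))%:E *
    (expR (theta * a1%:R) * poi (l1 * u) a1)%:E))%E.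
  apply: eq_eseriesr => a1 _; rewrite -nneseries_poi_exp// muleC -nneseriesZl; last first.
    by move=> a2 _; rewrite lee_fin mulr_ge0 ?expR_ge0// poi_ge0.
  apply: eq_eseriesr => a2 _; rewrite -EFinM; congr EFin.
  rewrite rmorphB/= mulrBr expRD -mulNr.
  by ring.
rewrite nneseriesZl; last first.
  by move=> a1 _; rewrite lee_fin mulr_ge0 ?expR_ge0// poi_ge0.
rewrite nneseries_poi_exp// -EFinM -expRD /skellam_exponent opprK; congr (expR _)%:E.
by ring.
Qed.

End skellam.

(** * Wright form and Laplace transform of the density *)

Section inverse_density_transforms.
Context {R : realType}.
Notation mu := (@lebesgue_measure R).
Variables (n : nat) (b l t : R).
Hypotheses (b0 : 0 < b) (l0 : 0 < l) (t0 : 0 <= t).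

Let bt0 : 0 <= b * t. Proof. by rewrite mulr_ge0// ltW. Qed.

Let D : set R := `[0%R, +oo[%classic.

Let D0 u : D u -> 0 <= u. Proof. by rewrite /D/= in_itv/= andbT. Qed.

Lemma inverse_densityE u : 0 <= u -> inverse_density n b l t u =
  (l * expR (- (b * t)) * expR (- (l * u)) *
   \sum_(i < n.+1) (b * t) ^+ i * wright n.+1%:R i.+1%:R (l * u * (b * t) ^+ n.+1))%:E.
Proof.
move=> u0; have lu0 : 0 <= l * u by rewrite mulr_ge0// ltW.
have z0 : 0 <= l * u * (b * t) ^+ n.+1 by rewrite mulr_ge0// exprn_ge0.
rewrite mulr_sumr -sumEFin /inverse_density.
transitivity (\sum_(m <oo) \sum_(i < n.+1)
    (poi (b * t) (m * n.+1 + i) * (l * poi (l * u) m))%:E)%E.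
  by apply: eq_eseriesr => m _; rewrite /crossing mulr_suml sumEFin.
rewrite nneseries_sum; last first.
  move=> i m _; rewrite lee_fin mulr_ge0 ?poi_ge0//.
  by rewrite mulr_ge0 ?poi_ge0// ltW.
apply: eq_bigr => i _; rewrite mulrA EFinM wrightE// -nneseriesZl; last first.
  by move=> m _; rewrite lee_fin divr_ge0// exp_coeff_ge0.
apply: eq_eseriesr => m _; rewrite -EFinM; congr EFin.
rewrite /poi /exp_coeff/= exprD (mulnC m) exprM (exprMn _ (l * u)).
by ring.
Qed.

Let mexp (s : R) : measurable_fun D (fun u => (expR (- (u * s)))%:E).
Proof.
apply/measurable_EFinP; apply: measurable_funTS.
apply: (measurableT_comp (f := expR)) => //; apply: measurable_funN => //.
exact: measurable_funM.
Qed.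

(** Exponential tilting: [expR (- (u * s))] times the Erlang density of shape [m + 1] and rate [l]
    is [(l / c) ^+ m.+1] times the one of rate [c = l + s], which has mass 1. Each block of Poisson
    weights is then regrouped by rank. *)
Lemma integral_exp_inverse_density s : 0 < l + s ->
  (\int[mu]_(u in D) ((expR (- (u * s)))%:E * inverse_density n b l t u) =
   (expR (- (b * t)) * (l / (l + s)) *
    \sum_(i < n.+1) (b * t) ^+ i *
      mittag_leffler n.+1%:R i.+1%:R (l * (b * t) ^+ n.+1 / (l + s)))%:E)%E.
Proof.
set c := l + s => c0; have lc0 : 0 <= l / c by rewrite divr_ge0// ltW.
have z0 : 0 <= l * (b * t) ^+ n.+1 / c.
  by rewrite mulrAC mulr_ge0// exprn_ge0.
have q0 m : 0 <= crossing n b t m * (l / c) ^+ m.+1.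
  by rewrite mulr_ge0 ?crossing_ge0// exprn_ge0.
pose h m u := ((crossing n b t m * (l / c) ^+ m.+1)%:E * (c * poi (c * u) m)%:E)%E.
have cp0 m u : D u -> (0 <= (c * poi (c * u) m)%:E)%E.
  by move=> /D0 u0; rewrite lee_fin mulr_ge0 ?(ltW c0)// poi_ge0// mulr_ge0// ltW.
transitivity (\int[mu]_(u in D) \sum_(m <oo) h m u)%E.
  apply: eq_integral => u; rewrite inE => Du; have u0 := D0 Du.
  rewrite /inverse_density -nneseriesZl; last first.
    move=> m _; rewrite lee_fin mulr_ge0 ?crossing_ge0// mulr_ge0 ?(ltW l0)//.
    by rewrite poi_ge0// mulr_ge0// ltW.
  apply: eq_eseriesr => m _; rewrite /h -!EFinM; congr EFin.
  have -> : expR (- (u * s)) = expR (- (c * u)) * expR (l * u).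
    by rewrite -expRD; congr expR; rewrite /c; ring.
  rewrite /poi /exp_coeff/= expRN.
  have -> : (l * u) ^+ m = (l / c) ^+ m * (c * u) ^+ m.
    by rewrite -exprMn; congr (_ ^+ _); field; rewrite gt_eqF.
  rewrite exprSr.
  have e0 : expR (l * u) != 0 by rewrite gt_eqF// expR_gt0.
  have cn0 : c != 0 by rewrite gt_eqF.
  have f0 : m`!%:R != 0 :> R by rewrite pnatr_eq0 -lt0n fact_gt0.
  have e1 : expR (c * u) != 0 by rewrite gt_eqF// expR_gt0.
  rewrite [expR (- (l * u))]expRN.
  move: ((l / c) ^+ m) ((c * u) ^+ m) (expR (l * u)) (expR (c * u)) e0 e1 => x1 x2 x3 x4 e0 e1.
  by field; rewrite ?cn0 ?f0 ?e0 ?e1.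
rewrite integral_nneseries//; last 3 first.
- exact: measurable_itv.
- by move=> m; apply: emeasurable_funM => //; exact: measurable_scaled_poi.
- by move=> m u Du; rewrite mule_ge0 ?cp0// lee_fin.
transitivity (\sum_(m <oo) (crossing n b t m * (l / c) ^+ m.+1)%:E)%E.
  apply: eq_eseriesr => m _; rewrite ge0_integralZl//.
  - by rewrite integral_poi_itvcy// mulr0 poi_sum0 mule1.
  - exact: measurable_itv.
  - exact: measurable_scaled_poi.
  - by move=> u; exact: cp0.
  - by rewrite lee_fin.
transitivity (\sum_(m <oo) \sum_(i < n.+1)
    (poi (b * t) (m * n.+1 + i) * (l / c) ^+ m.+1)%:E)%E.
  by apply: eq_eseriesr => m _; rewrite /crossing mulr_suml sumEFin.
rewrite nneseries_sum; last first.
  by move=> i m _; rewrite lee_fin mulr_ge0 ?poi_ge0// exprn_ge0.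
rewrite mulr_sumr -sumEFin.
apply: eq_bigr => i _; rewrite mulrA EFinM mittag_lefflerE// -nneseriesZl; last first.
  by move=> m _; rewrite lee_fin divr_ge0// exprn_ge0.
apply: eq_eseriesr => m _; rewrite -EFinM; congr EFin.
rewrite /poi /exp_coeff/= exprD (mulnC m) exprM.
rewrite [l * _ / _]mulrAC (exprMn _ (l / c)) (exprS (l / c)).
by ring.
Qed.

(** The term [m = 0] of the density decays like [expR (- (l * u))], which the growing exponential
    outweighs; the integrand stays above a positive constant on the whole half-line. *)
Lemma integral_exp_inverse_density_pinfty s : l + s < 0 ->
  (\int[mu]_(u in D) ((expR (- (u * s)))%:E * inverse_density n b l t u) = +oo)%E.
Proof.
move=> c0; apply/eqP; rewrite -leye_eq.
(* [expR (- (b * t))] is the first weight in [crossing 0], and [l] is the prefactor of the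
   exponential density. *)
pose q := expR (- (b * t)) * l.
have q0 : 0 < q by rewrite mulr_gt0// expR_gt0.
apply: (@le_trans _ _ (\int[mu]_(u in D) (cst q%:E) u)%E).
  rewrite integral_cst; last exact: measurable_itv.
  by rewrite /= /D lebesgue_measure_itv/= ltry gt0_muley// lte_fin.
apply: ge0_le_integral => //.
- exact: measurable_itv.
- by move=> u _; rewrite lee_fin ltW.
- by apply: (@emeasurable_funM _ _ R D); [exact: mexp|exact: measurable_inverse_density].
move=> u Du; have u0 := D0 Du.
apply: (@le_trans _ _ ((expR (- (u * s)))%:E *
    (crossing n b t 0 * (l * poi (l * u) 0))%:E)%E).
  rewrite -EFinM lee_fin.
  have -> : poi (l * u) 0 = expR (- (l * u)).
    by rewrite /poi /exp_coeff/= expr0 divr1 mul1r.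
  have -> : expR (- (u * s)) * (crossing n b t 0 * (l * expR (- (l * u)))) =
      crossing n b t 0 * (expR (- (u * s)) * expR (- (l * u)) * l) by ring.
  rewrite -expRD.
  apply: ler_pM; rewrite ?expR_ge0 ?(ltW l0)//.
    rewrite /crossing big_ord_recl/= -[leLHS]addr0 lerD//.
      by rewrite /poi /exp_coeff/= expr0 divr1 mul1r.
    by apply: sumr_ge0 => i _; exact: poi_ge0.
  rewrite ler_peMl ?(ltW l0)// -expR0 ler_expR.
  have -> : - (u * s) + - (l * u) = - (l + s) * u by ring.
  by rewrite mulr_ge0// oppr_ge0 ltW.
rewrite lee_wpmul2l ?lee_fin ?expR_ge0//.
have := @nneseries_lim_ge R (fun m => (crossing n b t m * (l * poi (l * u) m))%:E) xpredT 0 1.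
rewrite big_nat1; apply => m _ _.
rewrite lee_fin mulr_ge0 ?crossing_ge0// mulr_ge0 ?(ltW l0)//.
by rewrite poi_ge0// mulr_ge0// ltW.
Qed.

End inverse_density_transforms.
Theorem theorem10 (R : realType) (d : measure_display) (T : measurableType d)
    (P : probability T R)
    (n : nat) (lambda lambda1 lambda2 beta : R)
    (GN : R -> T -> R) (N1 N2 : R -> T -> nat) :
  (1 <= n)%N -> 0 < lambda -> 0 < lambda1 -> 0 < lambda2 -> 0 < beta ->
  compound_poisson_erlang P lambda n beta GN ->
  poisson_process P lambda1 N1 ->
  poisson_process P lambda2 N2 ->
  let Y := inverse_process GN in
  mutually_independent P (tnth [tuple salgebra_of_process N1;
                                      salgebra_of_process N2;
                                      salgebra_of_process Y]) ->
  let S := time_changed_skellam N1 N2 Y in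
  let fs := skellam_exponent lambda1 lambda2 in
  forall t : R, 0 <= t ->
  (forall k : int,
    P [set w | S t w = k] =
    ((lambda * expR (- (beta * t)) * (lambda1 / lambda2) `^ (k%:~R / 2))%:E *
     \sum_(1 <= m < n.+1)
       ((beta * t) ^+ (m - 1))%:E *
       \int[lebesgue_measure]_(u in `[0%R, +oo[)
         (expR (- (u * (lambda1 + lambda2 + lambda))) *
          besselI `|k|%N (2 * u * Num.sqrt (lambda1 * lambda2)) *
          wright n%:R m%:R (lambda * u * (beta * t) ^+ n))%:E)%E) /\
  (forall theta : R,
    lambda + fs (- theta) != 0 ->
    let mgf := mmt_gen_fun P (fun w => (S t w)%:~R) theta in
    (0 < lambda + fs (- theta) -> (mgf < +oo)%E) /\
    ((mgf < +oo)%E ->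
     mgf =
     (expR (- (beta * t)) * (lambda / (lambda + fs (- theta))) *
      \sum_(1 <= k < n.+1)
        (beta * t) ^+ (k - 1) *
        mittag_leffler n%:R k%:R
          (lambda * (beta * t) ^+ n / (lambda + fs (- theta))))%:E)).
Proof.
move=> n1 l0 l10 l20 b0 [N [G [poissonN gammaG indepG indepNG XE]]] poissonN1 poissonN2 Y indep S fs t t0.
(* From here on [n] is the shape minus 1, as in the lemmas. *)
case: n n1 gammaG => // n _ gammaG.
pose D : set R := `[0%R, +oo[%classic.
have D0 u : D u -> 0 <= u by rewrite /D/= in_itv/= andbT.
pose f := inverse_density n beta lambda t.
have mf : measurable_fun D f by exact: measurable_inverse_density.
have f0 u : 0 <= u -> (0 <= f u)%E by move=> u0; exact: inverse_density_ge0.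
have bt0 : 0 <= beta * t by rewrite mulr_ge0// ltW.
have mY : measurable_fun setT (Y t) := measurable_inverse_process t poissonN gammaG XE.
have Y0 w : 0 <= Y t w := inverse_process_ge0 t GN w.
have fin x : 0 <= x -> f x \is a fin_num.
  by move=> x0; exact: inverse_density_fin_num.
have fy : (\int[lebesgue_measure]_(u in D) f u < +oo)%E.
  exact: integral_inverse_density_lty.
have cdfY x : 0 <= x ->
    P [set w | Y t w <= x] = (\int[lebesgue_measure]_(u in `[0%R, x]) f u)%E.
  by move=> x0; exact: (inverse_process_cdf l0 b0 t0 poissonN gammaG indepG indepNG XE).
have EY := integral_time_changed_pair l10 l20 t0 poissonN1 poissonN2 indep mY Y0
  mf f0 fin fy cdfY.
have pairY := time_changed_pair l10 l20 t0 poissonN1 poissonN2 indep mY Y0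
  mf f0 fin fy cdfY.
split=> [k|theta cneq0 mgf].
  (* At a random time only the events fixing both counts are known to be measurable; this one is a
     countable union of them. *)
  have mS : measurable [set w | S t w = k].
    have -> : [set w | S t w = k] = \bigcup_a1 \bigcup_a2
        (if a1%:Z - a2%:Z == k then
           [set w | N1 (Y t w) w = a1 /\ N2 (Y t w) w = a2] else set0).
      apply/seteqP; split => w.
        move=> <-; exists (N1 (Y t w) w) => //; exists (N2 (Y t w) w) => //.
        by rewrite eqxx.
      by move=> [a1 _ [a2 _]]; case: eqP => //= <- [<- <-].
    apply: bigcupT_measurable => a1; apply: bigcupT_measurable => a2.
    by case: ifP => // _; have [] := pairY a1 a2.
  pose bes u := besselI `|k|%N (2 * u * Num.sqrt (lambda1 * lambda2)).
  pose C := (lambda1 / lambda2) `^ (k%:~R / 2).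
  pose B i u := expR (- (u * (lambda1 + lambda2 + lambda))) * bes u *
    wright n.+1%:R i.+1%:R (lambda * u * (beta * t) ^+ n.+1).
  have B0 i u : D u -> (0 <= (B i u)%:E)%E.
    move=> /D0 u0; rewrite lee_fin mulr_ge0//.
      by rewrite mulr_ge0 ?expR_ge0// besselI_ge0// mulr_ge0 ?sqrtr_ge0// mulr_ge0.
    by rewrite wright_ge0// mulr_ge0 ?exprn_ge0// mulr_ge0// ltW.
  have mB i : measurable_fun D (fun u => (B i u)%:E).
    under eq_fun do rewrite /B /bes !EFinM.
    apply: emeasurable_funM; first apply: emeasurable_funM.
    - apply/measurable_EFinP; apply: measurable_funTS.
      apply: (measurableT_comp (f := expR)) => //; apply: measurable_funN => //.
      exact: measurable_funM.
    - under eq_fun do rewrite -mulrA mulrCA.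
      by apply: measurable_besselI; rewrite mulr_ge0 ?sqrtr_ge0.
    - under eq_fun do rewrite -mulrA mulrCA.
      by apply: measurable_wright; rewrite mulr_ge0 ?exprn_ge0// ltW.
  have mcB i : measurable_fun D (fun u => ((beta * t) ^+ i)%:E * (B i u)%:E)%E.
    exact: emeasurable_funM.
  have msum : measurable_fun D
      (fun u => \sum_(i < n.+1) ((beta * t) ^+ i)%:E * (B i u)%:E)%E.
    exact: emeasurable_sum.
  transitivity (\int[lebesgue_measure]_(u in D)
    ((lambda * expR (- (beta * t)) * C)%:E *
     \sum_(i < n.+1) ((beta * t) ^+ i)%:E * (B i u)%:E))%E; last first.
    rewrite ge0_integralZl_EFin//; last 3 first.
    - exact: measurable_itv.
    - move=> u Du; apply: sume_ge0 => i _.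
      by rewrite mule_ge0 ?B0// lee_fin exprn_ge0.
    - by rewrite mulr_ge0 ?powR_ge0// mulr_ge0 ?expR_ge0// ltW.
    rewrite big_add1 big_mkord; congr (_ * _)%E.
    rewrite ge0_integral_sum//; last 3 first.
    - exact: measurable_itv.
    - by move=> i; exact: mcB.
    - by move=> i u Du; rewrite mule_ge0 ?B0// lee_fin exprn_ge0.
    apply: eq_bigr => i _; rewrite ge0_integralZl_EFin//.
    - by rewrite subSS subn0.
    - exact: measurable_itv.
    - by move=> u; exact: B0.
    - exact: mB.
    - by rewrite exprn_ge0.
  transitivity (\int[P]_w (((N1 (Y t w) w)%:Z - (N2 (Y t w) w)%:Z == k)%:R : R)%:E)%E.
    rewrite -[X in P X]setIT -integral_indic//; apply: eq_integral => w _.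
    rewrite indicE; congr (_%:R)%:E; congr nat_of_bool.
    by apply/idP/eqP; rewrite inE.
  rewrite (EY (fun a1 a2 => (a1%:Z - a2%:Z == k)%:R))//.
  apply: eq_integral => u; rewrite inE => /D0 u0.
  rewrite skellam_pmf// /f inverse_densityE//.
  under [in RHS]eq_bigr do rewrite -EFinM.
  rewrite sumEFin -!EFinM; congr EFin.
  rewrite !mulr_sumr; apply: eq_bigr => i _; rewrite /B /bes -/C.
  have -> : expR (- (u * (lambda1 + lambda2 + lambda))) =
      expR (- (u * (lambda1 + lambda2))) * expR (- (lambda * u)).
    by rewrite -expRD; congr expR; ring.
  by ring.
have mgfE : mgf = (\int[lebesgue_measure]_(u in D)
    ((expR (- (u * fs (- theta))))%:E * f u))%E.
  rewrite /mgf /mmt_gen_fun unlock.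
  transitivity (\int[P]_w (expR (theta * ((N1 (Y t w) w)%:Z - (N2 (Y t w) w)%:Z)%:~R))%:E)%E.
    by apply: eq_integral => w _ /=; rewrite mulrC.
  rewrite (EY (fun a1 a2 => expR (theta * (a1%:Z - a2%:Z)%:~R)))//.
  by apply: eq_integral => u; rewrite inE => /D0 u0; rewrite skellam_mgf.
have mgf_pos : 0 < lambda + fs (- theta) -> mgf =
    (expR (- (beta * t)) * (lambda / (lambda + fs (- theta))) *
      \sum_(i < n.+1) (beta * t) ^+ i *
        mittag_leffler n.+1%:R i.+1%:R
          (lambda * (beta * t) ^+ n.+1 / (lambda + fs (- theta))))%:E.
  by move=> c0; rewrite mgfE integral_exp_inverse_density.
split=> [/mgf_pos ->|]; first exact: ltry.
(* A negative denominator makes the transform infinite, against the assumed finiteness, and zero is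
   excluded; only the positive case remains. *)
have [/integral_exp_inverse_density_pinfty c0|c0|/eqP] := ltgtP (lambda + fs (- theta)) 0.
- by rewrite mgfE c0.
- move=> _; rewrite mgf_pos// big_add1 big_mkord.
  by under [in RHS]eq_bigr do rewrite subSS subn0.
- by rewrite (negbTE cneq0).
Qed.
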